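(* There exists a universal constant $C>0$ such that for every probability measure $\mu$ on $\mathbb{R}$ with mean $0$ and variance $1$ that is infinitely divisible with respect to classical convolution $*$, $$d_{Kol}(\mathcal{N}(0,1),\mu)\leq C\sqrt{m_4-3},$$ where $m_4=\int_{\mathbb{R}}x^4\,\mu(dx)$ denotes the fourth moment of $\mu$.
   Context: $\mathcal{N}(0,1)$ is the standard Gaussian law. For probability measures $\mu,\nu$ on $\mathbb{R}$ with distribution functions $F_\mu(x)=\mu((-\infty,x])$ and $F_\nu(x)=\nu((-\infty,x])$, the Kolmogorov distance is $d_{Kol}(\mu,\nu)=\sup_{x\in\mathbb{R}}|F_\mu(x)-F_\nu(x)|$. A probability measure $\mu$ on $\mathbb{R}$ is $n$-divisible with respect to classical convolution $*$ if $\mu=\rho^{*n}$ (the $n$-fold convolution) for some probability measure $\rho$ on $\mathbb{R}$; it is infinitely divisible with respect to $*$ if it is $n$-divisible for all integers $n\geq 1$. The bound is only meaningful when $m_4<\infty$; when $m_4=\infty$ the right-hand side is read as $+\infty$. *)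

(* Defs.v *)
From HB Require Import structures.
From mathcomp Require Import all_boot all_order all_algebra.
From mathcomp Require Import all_classical all_reals all_analysis.

Set Implicit Arguments.
Unset Strict Implicit.
Unset Printing Implicit Defensive.

Import Order.TTheory GRing.Theory Num.Theory.
Import numFieldNormedType.Exports.

Local Open Scope classical_set_scope.
Local Open Scope ring_scope.
Local Open Scope ereal_scope.

Definition law (R : realType) := probability (measurableTypeR R) R.

Definition distribution_function (R : realType) (mu : law R) (x : R) : \bar R :=
  mu `]-oo, x]%classic.

Definition kolmogorov_distance (R : realType) (mu nu : law R) : \bar R :=
  ereal_sup
    (range (fun x : R =>
       `|distribution_function mu x - distribution_function nu x|)).

Definition convolution (R : realType)
    (mu nu : set (measurableTypeR R) -> \bar R) :
    set (measurableTypeR R) -> \bar R :=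
  pushforward (mu \x nu) (fun p : measurableTypeR R * measurableTypeR R =>
    (p.1 + p.2)%R : measurableTypeR R).

Section convolution_law.
Context (R : realType) (mu nu : law R).

Let madd : measurable_fun [set: measurableTypeR R * measurableTypeR R]
  (fun p : measurableTypeR R * measurableTypeR R =>
    (p.1 + p.2)%R : measurableTypeR R).
Proof. exact: (@measurable_realfun.measurable_funD _ _ R _ fst snd). Qed.

Let convolution0 : convolution mu nu set0 = 0.
Proof. by rewrite /convolution /pushforward preimage_set0 measure0. Qed.

Let convolution_ge0 A : 0 <= convolution mu nu A.
Proof. exact: measure_ge0. Qed.

Let convolution_sigma_additive : semi_sigma_additive (convolution mu nu).
Proof.
pose m := measure_function_pushforward__canonical__measure_function_Measure
  (mu \x nu) madd.
exact: (@measure_semi_sigma_additive _ _ _ m).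
Qed.

HB.instance Definition _ := isMeasure.Build _ _ _ (convolution mu nu)
  convolution0 convolution_ge0 convolution_sigma_additive.

Let convolution_setT : convolution mu nu [set: measurableTypeR R] = 1.
Proof.
rewrite /convolution /pushforward preimage_setT -setXTT product_measure1E//.
by rewrite -[RHS]mule1; congr (_ * _); exact: probability_setT.
Qed.

HB.instance Definition _ :=
  @Measure_isProbability.Build _ _ R (convolution mu nu) convolution_setT.

End convolution_law.

Fixpoint convolution_power (R : realType) (rho : law R) (n : nat) : law R :=
  if n is k.+1 then convolution rho (convolution_power rho k)
  else \d_(0%R : measurableTypeR R).

(* Laws are compared on Borel sets: their values on other sets are junk. *)
Definition n_divisible (R : realType) (n : nat) (mu : law R) : Prop :=
  exists rho : law R, forall A : set (measurableTypeR R), measurable A ->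
    mu A = convolution_power rho n A.

Definition infinitely_divisible (R : realType) (mu : law R) : Prop :=
  forall n : nat, (1 <= n)%N -> n_divisible n mu.

Definition fourth_moment (R : realType) (mu : law R) : \bar R :=
  \int[mu]_x ((x : R) ^+ 4)%:E.

(* Main.v *)
(** Stein's method, without Fourier analysis.  For every N, mu is the law of
    X = Y + W with Y and W independent, Y distributed as an N-fold convolution
    root rho of mu and W as rho^{*(N-1)}.  By exchangeability of the N summands
      E[X f(X)] = N E[Y (f(Y + W) - f(W))],
    which gives E Y = 0, N E Y^2 = 1 and N E Y^4 = m_4 - 3 + 3/N.  If t satisfies
    N E Y^4 <= t^2 and 1/N <= t^2, then
    - testing with a clipped linear f bounds P(W in [a, b]) by (b - a) + 4t;
    - testing with the bounded solution f of f' = x f + h - E h(Z), Z standard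
      normal and h a ramp of width t, bounds |E h(X) - E h(Z)| by a multiple of
      t: f' oscillates little along the shift by Y because W does not
      concentrate near the ramp.
    Letting N tend to infinity, t may be any number above sqrt(m_4 - 3). *)

Require Import Defs.
From HB Require Import structures.
From mathcomp Require Import all_boot all_order all_algebra.
From mathcomp Require Import all_classical all_reals all_analysis.
From mathcomp Require Import measurable_realfun ring lra.

Import Order.TTheory GRing.Theory Num.Theory.
Import numFieldNormedType.Exports.

Local Open Scope classical_set_scope.
Local Open Scope ring_scope.

(** * Stein's equation for the standard normal law *)

Section Stein.
Context {R : realType}.
Implicit Types (f h k F : R -> R) (x y z : R).

(** The obstacle is the ramp, whose slope is 1/t. After Stein's equation, the error contains the
    increment of h along the shift by Y, weighted by 1 + N Y^2. A Lipschitz bound would give (E|Y| +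
    N E|Y|^3) / t, and N E|Y|^3 is only known to be of order t, so nothing small would come out.
    Instead the increment is bounded by the oscillation of h on [W - |Y|, W + |Y|], which vanishes
    unless W lies within |Y| of the ramp. For fixed Y = y, which independence permits, this has
    probability at most 5t + 2|y|; averaging against the weight gives O(t). The increment of the
    other part x f of f' is at most a constant times (1 + |W|)|Y|, with no factor 1/t. *)

Lemma derivable_everywhere_continuous (f df : R -> R) :
  (forall x, is_derive x 1 f (df x)) -> continuous f.
Proof.
move=> fdf x; apply: differentiable_continuous.
by apply/derivable1_diffP; exact: (@ex_derive _ _ _ _ _ _ _ (fdf x)).
Qed.

(** The offset form treats both signs of [u] at once and keeps [|v| <= |u|], which is what the
    estimate of the derivative relies on. *)
Lemma mean_value (f df : R -> R) x u :
  (forall x, is_derive x 1 f (df x)) ->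
  exists2 v, `|v| <= `|u| & f (x + u) - f x = df (x + v) * u.
Proof.
move=> fdf; have fc := derivable_everywhere_continuous _ _ fdf.
have [u0|/ltW u0] := leP 0 u.
- have [c] := @MVT_segment R f df x (x + u) ltac:(lra) (fun y _ => fdf y)
    (continuous_subspaceT fc).
  rewrite in_itv/= => /andP[xc cu] ->; exists (c - x).
    by rewrite !ger0_norm//; lra.
  by congr (df _ * _); lra.
- have [c] := @MVT_segment R f df (x + u) x ltac:(lra) (fun y _ => fdf y)
    (continuous_subspaceT fc).
  rewrite in_itv/= => /andP[xc cu] E; exists (c - x).
    by rewrite !ler0_norm//; lra.
  rewrite (_ : x + (c - x) = c); last lra.
  by rewrite -[LHS]opprB E; ring.
Qed.

Let phi : R -> R := normal_pdf 0 1.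

Lemma standard_pdfE x : phi x = normal_peak 1 * expR (- x ^+ 2 / 2).
Proof.
by rewrite /phi normal_pdfE ?oner_eq0// /normal_fun subr0 expr1n.
Qed.

Lemma standard_peak_gt0 : 0 < normal_peak (1 : R).
Proof. by rewrite normal_peak_gt0 ?oner_eq0. Qed.

Lemma standard_pdf_gt0 x : 0 < phi x.
Proof. by rewrite standard_pdfE mulr_gt0 ?expR_gt0 ?standard_peak_gt0. Qed.

Lemma standard_pdf_le1 x : phi x <= 1.
Proof.
have s0 : (1 : R) != 0 by rewrite oner_eq0.
apply: (le_trans (normal_pdf_ub 0 x s0)).
rewrite /normal_peak invf_le1 ?sqrtr_gt0 ?expr1n ?mul1r.
  rewrite -[leLHS]sqrtr1 ler_sqrt//; have := pi_ge2 R; lra.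
have := pi_ge2 R; lra.
Qed.

Lemma standard_pdf_even x : phi (- x) = phi x.
Proof. by rewrite !standard_pdfE sqrrN. Qed.

Lemma is_derive_standard_pdf x : is_derive x 1 phi (- x * phi x).
Proof.
rewrite (_ : phi = (fun x => normal_peak 1 * expR (- x ^+ 2 / 2))); last first.
  by apply/funext => y; rewrite standard_pdfE.
apply: is_derive_eq; rewrite /GRing.scale/=.
by field.
Qed.

Lemma standard_pdf_ge x : `|x| <= 1 -> phi 1 <= phi x.
Proof.
move=> x1; rewrite !standard_pdfE ler_pM2l ?standard_peak_gt0// ler_expR.
have : x ^+ 2 <= 1 by rewrite -real_normK ?num_real// expr_le1.
by rewrite expr1n; lra.
Qed.

(* F - phi(x)/x is nondecreasing on the positive half-line, with limit 0. *)
Lemma mills_upper (F k : R -> R) x :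
  (forall x, is_derive x 1 F (k x * phi x)) -> (forall x, `|k x| <= 1) ->
  F @ +oo --> 0 -> 0 < x -> x * F x <= phi x.
Proof.
move=> dF k1 F0 x0.
rewrite -(@ler_pM2l _ x^-1) ?invr_gt0// mulKf ?gt_eqF//.
have mon (y : R) : x <= y -> F x - x^-1 * phi x <= F y - y^-1 * phi y.
  move=> xy.
  pose G t := F t - t^-1 * phi t.
  (* As [phi' = - t * phi], the derivative of [- phi t / t] is [(1 + t ^- 2) * phi t]; adding
     [k t * phi t] keeps it nonnegative because [k >= -1]. *)
  pose dG t := (k t + 1 + t ^- 2) * phi t.
  have dGP (t : R) : 0 < t -> is_derive t 1 G (dG t).
    move=> t0; have tn0 : t != 0 by rewrite gt_eqF.
    have d1 := @is_deriveV R id t 1 1 tn0 (is_derive_id _ _).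
    have d2 := is_derive_standard_pdf t.
    have d3 := is_deriveM d1 d2.
    have d4 := is_deriveB (dF t) d3.
    apply: is_derive_eq.
    by rewrite /dG /GRing.scale/=; field.
  have [c] := @MVT_segment R G dG x y xy
    (fun t ht => dGP t ltac:(move: ht; rewrite in_itv/= => /andP[+ _]; lra))
    ltac:(apply: derivable_within_continuous => t; rewrite in_itv/= =>
      /andP[+ _] => xt; apply: (@ex_derive _ _ _ _ _ _ _ (dGP t _)); lra).
  rewrite in_itv/= => /andP[xc _] E.
  have : 0 <= G y - G x.
    rewrite E mulr_ge0 ?subr_ge0// mulr_ge0// ?(ltW (standard_pdf_gt0 _))//.
    have := k1 c; rewrite ler_norml => /andP[kc _].
    by rewrite addr_ge0// ?invr_ge0 ?sqr_ge0//; lra.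
  by rewrite subr_ge0.
rewrite -subr_le0 -(cvg_lim (@Rhausdorff R) F0).
apply: limr_ge; first by apply/cvg_ex; exists 0.
near=> y.
have xy : x <= y by near: y; apply: nbhs_pinfty_ge; rewrite num_real.
apply: (le_trans (mon y xy)); rewrite gerBl mulr_ge0// ?invr_ge0 ?(ltW (standard_pdf_gt0 _))//.
Unshelve. all: by end_near. Qed.

(** The hypotheses are stable under [F -> - F] (weight [- k]) and under reflection (weight
    [- k (- x)]), so the one-sided bound on the positive half-line yields the absolute value and the
    negative half-line. *)
Lemma mills_bound (F k : R -> R) x :
  (forall x, is_derive x 1 F (k x * phi x)) -> (forall x, `|k x| <= 1) ->
  F @ +oo --> 0 -> F @ -oo --> 0 -> `|x * F x| <= phi x.
Proof.
have pos (G j : R -> R) y :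
    (forall x, is_derive x 1 G (j x * phi x)) -> (forall x, `|j x| <= 1) ->
    G @ +oo --> 0 -> 0 < y -> `|y * G y| <= phi y.
  move=> dG j1 G0 y0; rewrite ler_norml; apply/andP; split; last first.
    exact: mills_upper dG j1 G0 y0.
  rewrite lerNl -mulrN; apply: (mills_upper (fun x => - G x) (fun x => - j x)) => //.
  - by move=> t; apply: is_derive_eq; rewrite mulNr.
  - by move=> t; rewrite normrN.
  - by rewrite -[X in _ --> X]oppr0; apply: (@cvgN _ R^o).
move=> dF k1 Fy Fn; have [x0|x0|<-] := ltgtP 0 x.
- exact: pos dF k1 Fy x0.
- rewrite -standard_pdf_even -normrN -mulNr -[in F _](opprK x).
  apply: (pos (fun x => F (- x)) (fun x => - k (- x))) => //.
  + move=> t; have dN : is_derive t 1 (-%R : R -> R) (- 1).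
      exact: is_deriveN.
    have := @is_derive1_comp R F -%R t _ _ (dF (- t)) dN.
    by move=> d; apply: is_derive_eq; rewrite standard_pdf_even; ring.
  + by move=> t; rewrite normrN.
  + by apply/cvgNy_compNP.
  + by rewrite oppr_gt0.
- by rewrite mul0r normr0 ltW// standard_pdf_gt0.
Qed.

End Stein.

(** * Bounded solutions of Stein's equation *)

Section SteinEquation.
Context {R : realType}.
Let phi : R -> R := normal_pdf 0 1.
Let gauss : law R := normal_prob 0 1.

(** The identity as a random variable under [gauss]: the limits of its [cdf] and [ccdf] are the
    decay of the Gaussian tails. *)
Let idR : measurableTypeR R -> R := idfun.
HB.instance Definition _ :=
  @isMeasurableFun.Build _ _ _ _ idR (@measurable_id _ _ setT).
Let idRV : {RV gauss >-> R} := idR.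

Lemma standard_normal_probE (A : set R) : measurable A ->
  (gauss A = (\int[lebesgue_measure]_(t in A) phi t)%:E)%E.
Proof.
move=> mA; rewrite /gauss/= /normal_prob /Rintegral fineK//.
apply: integrable_fin_num => //.
by apply: (@integrableS _ _ R lebesgue_measure setT A) => //; exact: integrable_normal_pdf.
Qed.

Let lower (x : R) : R := \int[lebesgue_measure]_(t in `]-oo, x]) phi t.
Let upper (x : R) : R := \int[lebesgue_measure]_(t in `]x, +oo[) phi t.

Let lower_cvg : lower @ -oo --> 0.
Proof.
have := cvg_cdfNy0 idRV.
rewrite (_ : cdf idRV = EFin \o lower); last first.
  by apply/funext => r /=; rewrite -standard_normal_probE.
by move/fine_cvg.
Qed.

Let upper_cvg : upper @ +oo --> 0.
Proof.
have := cvg_ccdfy0 idRV.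
rewrite (_ : ccdf idRV = EFin \o upper); last first.
  by apply/funext => r /=; rewrite -standard_normal_probE.
by move/fine_cvg.
Qed.

Context (k : R -> R) (k_cont : continuous k) (k_le1 : forall x, `|k x| <= 1).

Let kphi_cont : continuous (fun x => k x * phi x).
Proof.
move=> x; apply: (@cvgM _ _ _ _ k phi); first exact: k_cont.
by apply: continuous_normal_pdf; rewrite oner_eq0.
Qed.

Lemma weighted_pdf_integrable (A : set R) : measurable A ->
  lebesgue_measure.-integrable A (EFin \o (fun x => k x * phi x)).
Proof.
move=> mA; apply: (@integrableS _ _ R lebesgue_measure setT A) => //.
apply: (le_integrable _ _ _ (integrable_normal_pdf 0 1)) => //.
- by apply/measurable_EFinP; exact: continuous_measurable_fun.
- by move=> x _ /=; rewrite lee_fin normrM ler_piMl.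
Qed.

Let weighted_le (A : set R) : measurable A ->
  `|\int[lebesgue_measure]_(t in A) (k t * phi t)| <=
    \int[lebesgue_measure]_(t in A) phi t.
Proof.
move=> mA.
apply: (le_trans (le_normr_Rintegral _ _)) => //.
  exact: weighted_pdf_integrable.
apply: le_Rintegral => //.
- exact/integrable_norm/weighted_pdf_integrable.
- by apply: (@integrableS _ _ R lebesgue_measure setT A) => //; exact: integrable_normal_pdf.
- move=> x _; rewrite normrM (ger0_norm (normal_pdf_ge0 _ _ _)).
  by rewrite ler_piMl// normal_pdf_ge0.
Qed.

Hypothesis kphi0 : \int[lebesgue_measure]_t (k t * phi t) = 0.

Let F (x : R) : R := \int[lebesgue_measure]_(t in `]-oo, x]) (k t * phi t).

Let dF (x : R) : is_derive x 1 F (k x * phi x).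
Proof.
have [] := @continuous_FTC1 R (fun x => k x * phi x) -oo%O x (x + 1) _ _ _
  (kphi_cont x).
- by rewrite ltrDl.
- exact: weighted_pdf_integrable.
- by rewrite ltNyr.
by move=> d1 d2; apply: DeriveDef => //; rewrite -derive1E.
Qed.

(** The vanishing Gaussian mean of [k] enters here: it lets [F] be bounded by the upper tail as
    well, hence tend to 0 at both ends. *)
Let F_upper (x : R) : F x = - \int[lebesgue_measure]_(t in `]x, +oo[) (k t * phi t).
Proof.
apply/eqP; rewrite -addr_eq0; apply/eqP.
rewrite -Rintegral_setU//; first by rewrite itv_setU_setT.
- by apply: weighted_pdf_integrable; rewrite itv_setU_setT.
- exact: disjoint_rays.
Qed.

(** The integrating factor is [phi]: since [phi' = - x * phi], the quotient [f = F / phi] solves the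
    equation, and [mills_bound] is exactly [|x * f x| <= 1]. For [|x| > 1] this bounds [f] by 1; for
    [|x| <= 1], [|F| <= 1] and [phi x >= phi 1] bound it by [(phi 1)^-1]. The constant is the sum of
    the two. *)
Lemma stein_solution : exists f : R -> R,
  (forall x : R, is_derive x 1 f (x * f x + k x)) /\
  (forall x, `|f x| <= 1 + (phi 1)^-1) /\ (forall x, `|x * f x| <= 1).
Proof.
have phi0 x : 0 < phi x by exact: standard_pdf_gt0.
have Fl x : `|F x| <= lower x by exact: weighted_le.
have Fu x : `|F x| <= upper x by rewrite F_upper normrN; exact: weighted_le.
have lower_le1 x : lower x <= 1.
  by rewrite -lee_fin -standard_normal_probE//; exact: probability_le1.
have Fn : F @ -oo --> 0.
  apply: (@squeeze_cvgr _ _ _ _ (fun x => - lower x) lower) => //.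
    by near=> x; rewrite -ler_norml.
  by rewrite -oppr0; exact: (@cvgN _ R^o).
have Fy : F @ +oo --> 0.
  apply: (@squeeze_cvgr _ _ _ _ (fun x => - upper x) upper) => //.
    by near=> x; rewrite -ler_norml.
  by rewrite -oppr0; exact: (@cvgN _ R^o).
have mills x : `|x * F x| <= phi x by exact: mills_bound dF k_le1 Fy Fn.
have xf x : `|x * (F x / phi x)| <= 1.
  by rewrite mulrA normrM normfV (gtr0_norm (phi0 x)) ler_pdivrMr ?mul1r.
exists (fun x => F x / phi x); split; [|split] => // x.
- have pn : phi x != 0 by rewrite gt_eqF.
  have d0 : is_derive x 1 phi (- x * phi x) by exact: is_derive_standard_pdf.
  have d1 := @is_deriveV R phi x _ 1 pn d0.
  have d2 := is_deriveM (dF x) d1.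
  by apply: is_derive_eq; rewrite /GRing.scale/=; field.
- have [x1|x1] := leP `|x| 1.
    rewrite normrM normfV (gtr0_norm (phi0 x)).
    apply: (@le_trans _ _ (1 * (phi 1)^-1)); last by rewrite mul1r lerDr.
    apply: ler_pM => //; first by rewrite invr_ge0 ltW.
      exact: le_trans (Fl x) (lower_le1 x).
    by rewrite lef_pV2 ?posrE//; exact: standard_pdf_ge.
  apply: (@le_trans _ _ 1); last by rewrite lerDl invr_ge0 ltW.
  apply: le_trans (xf x); rewrite [leRHS]normrM ler_peMl// ltW//.
Unshelve. all: by end_near. Qed.

End SteinEquation.

(** * Smoothed indicators of half-lines *)

Section Ramp.
Context {R : realType}.
Let gauss : law R := normal_prob 0 1.
Let phi : R -> R := normal_pdf 0 1.

Definition Phi (z : R) : R := fine (gauss `]-oo, z]%classic).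

Let PhiE z : Phi z = \int[lebesgue_measure]_(t in `]-oo, z]) phi t.
Proof. by rewrite /Phi standard_normal_probE. Qed.

Let phi_int (A : set R) : measurable A ->
  lebesgue_measure.-integrable A (EFin \o phi).
Proof.
move=> mA; apply: (@integrableS _ _ R lebesgue_measure setT A) => //.
exact: integrable_normal_pdf.
Qed.

Let lebesgue_itv_fine (a b : R) : a <= b ->
  fine (lebesgue_measure `]a, b]) = b - a :> R.
Proof.
move=> ab; rewrite lebesgue_measure_itv/= lte_fin.
case: ltP => [_ //|ba]; have -> : a = b by apply/eqP; rewrite eq_le ab ba.
by rewrite subrr.
Qed.

Lemma Phi_increment z s : 0 <= s -> Phi (z + s) <= Phi z + s.
Proof.
move=> s0; rewrite !PhiE.
have E : `]-oo, z + s]%classic = `]-oo, z]%classic `|` `]z, z + s]%classic.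
  by rewrite -itv_bndbnd_setU// bnd_simp// lerDl.
rewrite E Rintegral_setU//; last 2 first.
- by apply: phi_int; exact: measurableU.
- apply/disj_setPS => x [] /=; rewrite !in_itv/= => xz /andP[zx _].
  by move: (le_lt_trans xz zx); rewrite ltxx.
rewrite lerD2l -[leRHS](addrK z) [s + z]addrC -lebesgue_itv_fine ?lerDl//.
rewrite -[leRHS]mul1r -Rintegral_cst//.
apply: le_Rintegral => //; first exact: phi_int.
- apply/integrableP; split; first exact: measurable_cst.
  rewrite integral_cst//= lebesgue_measure_itv/= normr1 mul1e.
  by case: ifP => // _; rewrite -EFinB ltry.
- by move=> x _; exact: standard_pdf_le1.
Qed.

(** For [s > 0], a continuous function lying between the indicators of []-oo, z]] and []-oo, z +
    s]]. *)
Definition ramp (z s x : R) : R := Num.max 0 (Num.min 1 ((z + s - x) / s)).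

Lemma ramp_ge0 z s x : 0 <= ramp z s x.
Proof. by rewrite /ramp le_max lexx. Qed.

Lemma ramp_le1 z s x : ramp z s x <= 1.
Proof. by rewrite /ramp ge_max ler01 ge_min lexx. Qed.

Lemma ramp_eq1 z s x : 0 < s -> x <= z -> ramp z s x = 1.
Proof.
move=> s0 xz; rewrite /ramp min_l; first by rewrite max_r.
by rewrite ler_pdivlMr//; lra.
Qed.

Lemma ramp_eq0 z s x : 0 < s -> z + s <= x -> ramp z s x = 0.
Proof.
move=> s0 xz; rewrite /ramp max_l// ge_min; apply/orP; right.
by rewrite ler_pdivrMr//; lra.
Qed.

Lemma ramp_continuous z s : continuous (ramp z s).
Proof.
move=> x; apply: (@continuous_max R R^o (fun=> 0) (fun x => Num.min 1 ((z + s - x) / s))).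
  exact: cvg_cst.
apply: (@continuous_min R R^o (fun=> 1) (fun x => (z + s - x) / s)).
  exact: cvg_cst.
apply: (@cvgM R _ _ _ (fun x => z + s - x) (fun=> s^-1)); last exact: cvg_cst.
by apply: (@cvgB R R^o); [exact: cvg_cst|exact: cvg_id].
Qed.

(** [c] is the Gaussian mean of the ramp, exported only through its position relative to [Phi]. Ramp
    and mean both lie in [0, 1], so their difference is an admissible right-hand side for
    [stein_solution]. *)
Lemma stein_ramp z s : 0 < s -> exists (c : R) (f : R -> R),
  [/\ Phi z <= c <= Phi z + s,
    forall x : R, is_derive x 1 f (x * f x + (ramp z s x - c)),
    forall x, `|ramp z s x - c| <= 1,
    forall x, `|f x| <= 1 + (phi 1)^-1 & forall x, `|x * f x| <= 1].
Proof.
move=> s0; pose h := ramp z s.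
have hle1 x : `|h x| <= 1 by rewrite ger0_norm ?ramp_ge0 ?ramp_le1.
have hphi (A : set R) : measurable A ->
    lebesgue_measure.-integrable A (EFin \o (fun x => h x * phi x)).
  by move=> mA; apply: weighted_pdf_integrable => //; exact: ramp_continuous.
pose c := \int[lebesgue_measure]_t (h t * phi t).
have phi1 : \int[lebesgue_measure]_t phi t = 1.
  by rewrite /Rintegral integral_normal_pdf.
have c0 : 0 <= c.
  by apply: Rintegral_ge0 => x _; rewrite mulr_ge0 ?ramp_ge0 ?normal_pdf_ge0.
have c1 : c <= 1.
  rewrite -phi1; apply: le_Rintegral => //; [exact: hphi|exact: phi_int|].
  by move=> x _; rewrite ler_piMl ?ramp_le1 ?normal_pdf_ge0.
have hc x : `|h x - c| <= 1.
  have := ramp_ge0 z s x; have := ramp_le1 z s x; rewrite -/h -/(h x) ler_norml.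
  lra.
have [f [df [fb xfb]]] : exists f : R -> R,
  (forall x : R, is_derive x 1 f (x * f x + (h x - c))) /\
  (forall x, `|f x| <= 1 + (phi 1)^-1) /\ (forall x, `|x * f x| <= 1).
  apply: stein_solution => //.
    move=> x; apply: (@cvgB R R^o); [exact: ramp_continuous|exact: cvg_cst].
  under eq_Rintegral do rewrite mulrBl.
  rewrite RintegralB//; [|exact: hphi|].
    by rewrite RintegralZl ?phi1 ?mulr1 ?subrr//; exact: phi_int.
  by apply: (integrableZl _ c (phi_int setT _)).
exists c, f; split => //; apply/andP; split.
- rewrite PhiE Rintegral_mkcond; apply: le_Rintegral => //.
  + by rewrite -restrict_EFin -integrable_mkcond//; exact: phi_int.
  + exact: hphi.
  + move=> x _; rewrite patchE; case: ifPn => [/set_mem/=|_].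
      by rewrite in_itv/= => xz; rewrite /h ramp_eq1// mul1r.
    by rewrite mulr_ge0 ?ramp_ge0 ?normal_pdf_ge0.
- apply: le_trans (Phi_increment z s (ltW s0)).
  rewrite PhiE Rintegral_mkcond; apply: le_Rintegral => //.
  + exact: hphi.
  + by rewrite -restrict_EFin -integrable_mkcond//; exact: phi_int.
  + move=> x _; rewrite patchE; case: ifPn => [_|/negP xz].
      by rewrite ler_piMl ?ramp_le1 ?normal_pdf_ge0.
    rewrite /h ramp_eq0 ?mul0r// leNgt; apply/negP => zx; apply: xz.
    by rewrite inE/= in_itv/= ltW.
Qed.

End Ramp.

(** * Functions of polynomial growth and convolutions *)

Section Growth.
Context {R : realType} {d : measure_display} {T : measurableType d}.
Context (w : T -> R) (w1 : forall x, 1 <= w x).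
Implicit Types F G : T -> R.

(** Measurability and a polynomial bound are bundled because the pair is stable under sums and
    products: integrability then reduces to the degree count [k <= 4]. The weight stays abstract to
    serve both the line and the plane. *)
Definition growth (k : nat) (F : T -> R) : Prop :=
  measurable_fun setT F /\ exists A, forall x, `|F x| <= A * w x ^+ k.

Let wk0 k x : 0 <= w x ^+ k.
Proof. by rewrite exprn_ge0// (le_trans ler01 (w1 x)). Qed.

Lemma growthW j k F : (j <= k)%N -> growth j F -> growth k F.
Proof.
move=> jk [mF [A FA]]; split => //; exists A => x; apply: (le_trans (FA x)).
rewrite -(subnKC jk) exprD mulrA ler_peMr//.
  exact: le_trans (normr_ge0 _) (FA x).
by rewrite exprn_ege1.
Qed.

Lemma growthD k F G : growth k F -> growth k G ->
  growth k (fun x => F x + G x).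
Proof.
move=> [mF [A FA]] [mG [B GB]]; split; first exact: measurable_funD.
by exists (A + B) => x; rewrite (le_trans (ler_normD _ _))// mulrDl lerD.
Qed.

Lemma growthM j k F G : growth j F -> growth k G ->
  growth (j + k) (fun x => F x * G x).
Proof.
move=> [mF [A FA]] [mG [B GB]]; split; first exact: measurable_funM.
by exists (A * B) => x; rewrite normrM exprD mulrACA ler_pM.
Qed.

Lemma growth_bounded A F : measurable_fun setT F -> (forall x, `|F x| <= A) ->
  growth 0 F.
Proof. by move=> mF FA; split => //; exists A => x; rewrite expr0 mulr1. Qed.

Lemma growth_cst c : growth 0 (fun=> c).
Proof. by apply: (growth_bounded `|c|) => //; exact: measurable_cst. Qed.

Lemma growthZ k c F : growth k F -> growth k (fun x => c * F x).
Proof. by move=> gF; rewrite -[k]add0n; apply: growthM => //; exact: growth_cst. Qed.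

Lemma growthN k F : growth k F -> growth k (fun x => - F x).
Proof.
by move=> /(growthZ _ (-1)); under eq_fun do rewrite mulN1r.
Qed.

Lemma growthB k F G : growth k F -> growth k G ->
  growth k (fun x => F x - G x).
Proof. by move=> gF gG; apply: growthD => //; exact: growthN. Qed.

Lemma growth_norm k F : growth k F -> growth k (fun x => `|F x|).
Proof.
move=> [mF [A FA]]; split; first exact: measurableT_comp.
by exists A => x; rewrite normr_id.
Qed.

Lemma growthX j k F : growth j F -> growth (j * k) (fun x => F x ^+ k).
Proof.
move=> gF; elim: k => [|k IH]; first by rewrite muln0; exact: growth_cst.
rewrite mulnS (_ : (fun x => _) = (fun x => F x * F x ^+ k)).
  exact: growthM.
by apply/funext => x; rewrite exprS.
Qed.

Lemma growth_integrable (P : {measure set T -> \bar R}) k F :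
  P.-integrable setT (EFin \o (fun x => w x ^+ 4)) -> (k <= 4)%N ->
  growth k F -> P.-integrable setT (EFin \o F).
Proof.
move=> Pw k4 /(growthW _ _ _ k4) [mF [A FA]].
have A0 x : 0 <= A * w x ^+ 4 by exact: le_trans (FA x).
apply: (le_integrable _ _ _ (integrableZl _ A Pw)) => //.
  exact/measurable_EFinP.
by move=> x _ /=; rewrite lee_fin (ger0_norm (A0 x)).
Qed.

End Growth.

(** * Growth on the line and on the plane *)

Section LineGrowth.
Context {R : realType}.
Implicit Types (f : R -> R) (F : R * R -> R).

Let weight (x : measurableTypeR R) : R := 1 + `|x|.
Let weight2 (p : measurableTypeR R * measurableTypeR R) : R :=
  weight p.1 * weight p.2.

Lemma weight_ge1 x : 1 <= weight x.
Proof. by rewrite /weight lerDl. Qed.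

Lemma weight2_ge1 p : 1 <= weight2 p.
Proof. by rewrite /weight2 -[1]mulr1 ler_pM// weight_ge1. Qed.

(* The weights are chosen so that 1 + |x + y| <= (1 + |x|)(1 + |y|):
   (x, y) |-> f (x + y) then has the growth of f. *)
Definition lgrowth (k : nat) (f : measurableTypeR R -> R) := growth weight k f.
Definition pgrowth (k : nat) (F : measurableTypeR R * measurableTypeR R -> R) :=
  growth weight2 k F.

Lemma lgrowth_id : lgrowth 1 (fun x => x).
Proof.
split; first exact: measurable_id.
by exists 1 => x; rewrite mul1r expr1 /weight lerDr.
Qed.

Lemma pgrowth_fst k f : lgrowth k f -> pgrowth k (fun p => f p.1).
Proof.
move=> [mf [A fA]]; split; first exact: (measurableT_comp mf).
exists A => p; apply: (le_trans (fA p.1)).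
have A0 : 0 <= A * weight p.1 ^+ k by exact: le_trans (fA p.1).
by rewrite exprMn mulrA ler_peMr// exprn_ege1// weight_ge1.
Qed.

Lemma pgrowth_snd k f : lgrowth k f -> pgrowth k (fun p => f p.2).
Proof.
move=> [mf [A fA]]; split; first exact: (measurableT_comp mf).
exists A => p; apply: (le_trans (fA p.2)).
have A0 : 0 <= A * weight p.2 ^+ k by exact: le_trans (fA p.2).
by rewrite exprMn mulrCA ler_peMl// exprn_ege1// weight_ge1.
Qed.

Lemma measurable_addp : measurable_fun
  [set: measurableTypeR R * measurableTypeR R]
  (fun p => (p.1 + p.2 : measurableTypeR R)).
Proof. exact: (@measurable_funD _ _ R _ fst snd). Qed.

Let weightD x y : weight (x + y) <= weight x * weight y.
Proof.
rewrite /weight mulrDl mul1r mulrDr mulr1; have := ler_normD x y.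
have : 0 <= `|x| * `|y| by rewrite mulr_ge0.
lra.
Qed.

Lemma pgrowth_add k f : lgrowth k f -> pgrowth k (fun p => f (p.1 + p.2)).
Proof.
move=> [mf [A fA]]; split; first exact: (measurableT_comp mf measurable_addp).
exists A => p; apply: (le_trans (fA _)).
have A0 : 0 <= A.
  have := le_trans (normr_ge0 _) (fA 0).
  by rewrite /weight normr0 addr0 expr1n mulr1.
rewrite ler_wpM2l// lerXn2r ?nnegrE ?(le_trans ler01) ?weight_ge1 ?weight2_ge1//.
Qed.

Lemma pgrowth_section k F y : pgrowth k F -> lgrowth k (fun x => F (y, x)).
Proof.
move=> [mF [A FA]]; split; first exact: (measurableT_comp mF).
by exists (A * weight y ^+ k) => x; rewrite (le_trans (FA _))// exprMn mulrA.
Qed.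

Lemma pgrowth_section2 k F y : pgrowth k F -> lgrowth k (fun x => F (x, y)).
Proof.
move=> [mF [A FA]]; split; first exact: (measurableT_comp mF).
by exists (A * weight y ^+ k) => x; rewrite (le_trans (FA _))// exprMn mulrA mulrAC.
Qed.

Definition finite_fourth_moment (mu : law R) := (fourth_moment mu < +oo)%E.

Lemma finite_fourth_moment_weight (mu : law R) : finite_fourth_moment mu ->
  mu.-integrable setT (EFin \o (fun x => weight x ^+ 4)).
Proof.
move=> mu4.
have i1 : mu.-integrable setT (EFin \o (fun x : R => x ^+ 4)).
  apply/integrableP; split; first by apply/measurable_EFinP; exact: measurable_funX.
  apply: le_lt_trans mu4; rewrite le_eqVlt; apply/orP; left; apply/eqP.
  by apply: eq_integral => x _ /=; rewrite ger0_norm// exprn_even_ge0.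
have i2 : mu.-integrable setT (EFin \o (fun x : R => 1)).
  exact: finite_measure_integrable_cst.
have i3 := integrableZl measurableT 8 (integrableD measurableT i1 i2).
apply: (le_integrable _ _ _ i3) => //.
  apply/measurable_EFinP/measurable_funX; apply: measurable_funD => //.
move=> x _ /=; rewrite lee_fin.
rewrite normrX ger0_norm ?(le_trans ler01 (weight_ge1 x))//.
apply: (le_trans _ (ler_norm _)).
have -> : x ^+ 4 = `|x| ^+ 4 by rewrite -normrX ger0_norm// exprn_even_ge0.
rewrite /weight.
move: `|x| (normr_ge0 x) => a a0.
(* The convexity bound [(1 + a)^4 <= 8 (1 + a^4)]; equality at [a = 1] accounts for the double
   root. *)
have -> : (8 * (a ^+ 4 + 1) = (1 + a) ^+ 4 + (a - 1) ^+ 2 * (7 * a ^+ 2 + 10 * a + 7)).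
  by ring.
by rewrite lerDl mulr_ge0 ?sqr_ge0//; rewrite !addr_ge0// ?mulr_ge0// sqr_ge0.
Qed.

Lemma lgrowth_integrable (mu : law R) k f : finite_fourth_moment mu -> (k <= 4)%N ->
  lgrowth k f -> mu.-integrable setT (EFin \o f).
Proof.
by move=> mu4 k4; apply: growth_integrable => //;
  [exact: weight_ge1|exact: finite_fourth_moment_weight].
Qed.

End LineGrowth.

(** * Fubini's theorem and integration against a convolution *)

Section Product.
Context {R : realType}.
Implicit Types (rho nu mu : law R) (f : R -> R) (F : R * R -> R).

Let weight (x : measurableTypeR R) : R := 1 + `|x|.

(** The fourth power of the plane weight is a product of functions of one coordinate, so by Tonelli
    its integral is the product of two finite ones. *)
Lemma pgrowth_integrable rho nu k (F : measurableTypeR R * measurableTypeR R -> R) :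
  finite_fourth_moment rho -> finite_fourth_moment nu -> (k <= 4)%N -> pgrowth k F ->
  (rho \x nu)%E.-integrable setT (EFin \o F).
Proof.
move=> rho4 nu4 k4; apply: growth_integrable => //; first exact: weight2_ge1.
have wm : measurable_fun [set: measurableTypeR R] weight.
  by apply: measurable_funD => //; exact: normr_measurable.
have w4 x : 0 <= weight x ^+ 4.
  by rewrite exprn_ge0// (le_trans ler01 (weight_ge1 x)).
have wfin mu : finite_fourth_moment mu -> (\int[mu]_x (weight x ^+ 4)%:E < +oo)%E.
  by move=> /finite_fourth_moment_weight/integrable_lty; apply.
apply/integrable12ltyP.
  apply/measurable_EFinP/measurable_funX; apply: measurable_funM.
    exact: (measurableT_comp wm).
  exact: (measurableT_comp wm).
rewrite (eq_integral (fun x : measurableTypeR R =>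
    (\int[nu]_y (weight y ^+ 4)%:E) * (weight x ^+ 4)%:E)%E); last first.
  move=> x _; rewrite /= -[RHS]muleC -ge0_integralZl//.
  - apply: eq_integral => y _ /=.
    by rewrite exprMn ger0_norm ?mulr_ge0// EFinM.
  - by apply/measurable_EFinP/measurable_funX.
  - by move=> y _; rewrite lee_fin.
  - by rewrite lee_fin.
rewrite ge0_integralZl//.
- apply: lte_mul_pinfty; rewrite ?ge0_fin_numE ?wfin//;
    by apply: integral_ge0 => y _; rewrite lee_fin.
- by apply/measurable_EFinP/measurable_funX.
- by move=> y _; rewrite lee_fin.
- by apply: integral_ge0 => y _; rewrite lee_fin.
Qed.

Lemma Rintegral_prod rho nu k (F : measurableTypeR R * measurableTypeR R -> R) :
  finite_fourth_moment rho -> finite_fourth_moment nu -> (k <= 4)%N -> pgrowth k F ->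
  \int[(rho \x nu)%E]_p F p = \int[rho]_x \int[nu]_y F (x, y).
Proof.
move=> rho4 nu4 k4 gF.
have iF := pgrowth_integrable _ _ _ _ rho4 nu4 k4 gF.
rewrite /Rintegral -(integral12_prod_meas1 iF); congr fine.
apply: eq_integral => x _; rewrite fineK//; apply: integrable_fin_num => //.
by apply: (lgrowth_integrable _ k) => //; exact: pgrowth_section.
Qed.

Lemma Rintegral_prod2 rho nu k (F : measurableTypeR R * measurableTypeR R -> R) :
  finite_fourth_moment rho -> finite_fourth_moment nu -> (k <= 4)%N -> pgrowth k F ->
  \int[(rho \x nu)%E]_p F p = \int[nu]_y \int[rho]_x F (x, y).
Proof.
move=> rho4 nu4 k4 gF.
have iF := pgrowth_integrable _ _ _ _ rho4 nu4 k4 gF.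
rewrite /Rintegral -(integral21_prod_meas1 iF); congr fine.
apply: eq_integral => x _; rewrite fineK//; apply: integrable_fin_num => //.
by apply: (lgrowth_integrable _ k) => //; exact: pgrowth_section2.
Qed.

Lemma lgrowth_Rintegral nu k (F : measurableTypeR R * measurableTypeR R -> R) :
  finite_fourth_moment nu -> (k <= 4)%N -> pgrowth k F ->
  lgrowth k (fun x => \int[nu]_y F (x, y)).
Proof.
move=> nu4 k4 gF; split.
  (* Only the measurability of the partial integral is extracted, so the first factor is arbitrary;
     [nu] has the required moment. *)
  have iF := pgrowth_integrable _ _ _ _ nu4 nu4 k4 gF.
  apply/measurable_EFinP; apply: eq_measurable_fun (measurable_fubini_F iF).
  move=> x _; rewrite /fubini_F /= fineK//; apply: integrable_fin_num => //.
  by apply: (lgrowth_integrable _ k) => //; exact: pgrowth_section.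
have [mF [A FA]] := gF.
exists (A * \int[nu]_y weight y ^+ k) => x.
have gx := pgrowth_section _ _ x gF.
have gw : lgrowth k (fun y => weight y ^+ k).
  rewrite -[k in lgrowth k]mul1n; apply: growthX; apply: growthD.
    by apply: (growthW _ _ 0 1) => //; [exact: weight_ge1|exact: growth_cst].
  by apply: growth_norm; exact: lgrowth_id.
apply: (le_trans (le_normr_Rintegral _ _)) => //.
  exact: lgrowth_integrable nu4 k4 gx.
rewrite -mulrA [_ * weight x ^+ k]mulrC mulrA -RintegralZl//; last first.
  exact: lgrowth_integrable nu4 k4 gw.
apply: le_Rintegral => //.
- by apply: (lgrowth_integrable _ k) => //; exact: growth_norm.
- by apply: (lgrowth_integrable _ k) => //; exact: growthZ.
- by move=> y _; rewrite (le_trans (FA _))// exprMn mulrA.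
Qed.

Lemma Rintegral_convolution rho nu k (f : measurableTypeR R -> R) :
  finite_fourth_moment rho -> finite_fourth_moment nu -> (k <= 4)%N -> lgrowth k f ->
  \int[convolution rho nu]_x f x = \int[(rho \x nu)%E]_p f (p.1 + p.2).
Proof.
move=> rho4 nu4 k4 gf; rewrite /Rintegral; congr fine.
(* The same set function as the convolution, but carrying the pushforward's measure structure, to
   which the change of variables applies. *)
pose m := measure_function_pushforward__canonical__measure_function_Measure
  (rho \x nu)%E (@measurable_addp R).
rewrite (eq_measure_integral m)//.
rewrite integral_pushforward//.
- exact: measurable_addp.
- by apply/measurable_EFinP; case: gf.
- rewrite preimage_setT.
  exact: (pgrowth_integrable _ _ _ _ rho4 nu4 k4 (pgrowth_add _ _ gf)).
Qed.

Lemma integral_convolution_ge0 rho nu (f : measurableTypeR R -> \bar R) :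
  measurable_fun setT f -> (forall x, (0 <= f x)%E) ->
  (\int[convolution rho nu]_x f x = \int[rho \x nu]_p f (p.1 + p.2)%R)%E.
Proof.
move=> mf f0.
pose m := measure_function_pushforward__canonical__measure_function_Measure
  (rho \x nu)%E (@measurable_addp R).
rewrite (eq_measure_integral m)//.
rewrite ge0_integral_pushforward//.
exact: measurable_addp.
Qed.

End Product.

(** * Fourth moments of convolutions and exchangeability *)

Section FourthMoment.
Context {R : realType}.
Implicit Types (rho nu mu : law R).

Let measurable_pow4 : measurable_fun [set: measurableTypeR R] (fun x : R => x ^+ 4).
Proof. exact: measurable_funX. Qed.

Let pow4_ge0 (x : R) : (0 <= (x ^+ 4)%:E)%E.
Proof. by rewrite lee_fin exprn_even_ge0. Qed.

Lemma finite_fourth_moment_shift mu (a : R) :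
  (\int[mu]_x ((a + x) ^+ 4)%:E < +oo)%E -> finite_fourth_moment mu.
Proof.
move=> h.
have ms : measurable_fun [set: measurableTypeR R] (fun x : R => (a + x) ^+ 4).
  by apply: measurable_funX; apply: measurable_funD => //; exact: measurable_cst.
have i1 : mu.-integrable setT (EFin \o (fun x : R => (a + x) ^+ 4)).
  apply/integrableP; split; first exact/measurable_EFinP.
  apply: le_lt_trans h; rewrite le_eqVlt; apply/orP; left; apply/eqP.
  by apply: eq_integral => x _ /=; rewrite ger0_norm// exprn_even_ge0.
have i2 : mu.-integrable setT (EFin \o (fun x : R => a ^+ 4)).
  exact: finite_measure_integrable_cst.
have i3 := integrableZl measurableT 8 (integrableD measurableT i1 i2).
have : mu.-integrable setT (EFin \o (fun x : R => x ^+ 4)).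
  apply: (le_integrable _ _ _ i3) => //.
    exact/measurable_EFinP.
  move=> x _ /=; rewrite lee_fin; apply: (le_trans _ (ler_norm _)).
  rewrite ger0_norm ?exprn_even_ge0//.
  have [b ->] : exists b, x = b - a by exists (x + a); ring.
  rewrite (_ : a + (b - a) = b); last by ring.
  (* Again the convexity bound, with equality at [b = - a]; the last factor is a positive
     semidefinite quadratic form. *)
  have -> : 8 * (b ^+ 4 + a ^+ 4) =
      (b - a) ^+ 4 + (b + a) ^+ 2 * (4 * (b - a) ^+ 2 + 3 * (b ^+ 2 + a ^+ 2) - 2 * a * b).
    by ring.
  rewrite lerDl mulr_ge0 ?sqr_ge0//.
  have := sqr_ge0 (b - a); have := sqr_ge0 a; have := sqr_ge0 b; nra.
by move/integrable_lty; apply.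
Qed.

Let pow4_addE rho nu : (fourth_moment (convolution rho nu) =
  \int[(rho \x nu)%E]_p ((p.1 + p.2) ^+ 4)%:E)%E.
Proof.
rewrite /fourth_moment.
rewrite (@integral_convolution_ge0 _ rho nu (fun x : R => (x ^+ 4)%:E))//.
exact/measurable_EFinP.
Qed.

Let measurable_pow4_add : measurable_fun
  [set: measurableTypeR R * measurableTypeR R]
  (fun p => ((p.1 + p.2) ^+ 4)%:E).
Proof. by apply/measurable_EFinP/measurable_funX; exact: measurable_addp. Qed.

Lemma finite_fourth_moment_convolution rho nu :
  finite_fourth_moment rho -> finite_fourth_moment nu ->
  finite_fourth_moment (convolution rho nu).
Proof.
move=> rho4 nu4; rewrite /finite_fourth_moment pow4_addE.
have g4 : lgrowth 4 (fun x : R => x ^+ 4) := growthX _ 1 4 _ lgrowth_id.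
by have /integrable_lty := pgrowth_integrable _ _ 4 _ rho4 nu4 isT
  (pgrowth_add _ _ g4); apply.
Qed.

Let integral_pinfty mu : (\int[mu]_x +oo = +oo)%E.
Proof. by rewrite integral_cst// [X in (_ * X)%E](probability_setT mu) mule1. Qed.

(** Divisibility supplies a root without any moment information. If [rho] had infinite fourth
    moment, so would each of its translates, and Tonelli would make that of the convolution
    infinite. *)
Lemma finite_fourth_moment_left rho nu :
  finite_fourth_moment (convolution rho nu) -> finite_fourth_moment rho.
Proof.
rewrite /finite_fourth_moment pow4_addE fubini_tonelli2//= => h.
apply: contrapT => rhoN; move: h; rewrite /fubini_G.
rewrite (eq_integral (cst +oo%E)) ?integral_pinfty// => y _ /=.
apply/eqP; rewrite -leye_eq leNgt; apply/negP => h; apply: rhoN.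
apply: (finite_fourth_moment_shift _ y); apply: le_lt_trans h; rewrite le_eqVlt; apply/orP; left.
by apply/eqP; apply: eq_integral => x _; rewrite addrC.
Qed.

Lemma finite_fourth_moment_convolution_power rho n :
  finite_fourth_moment rho ->
  finite_fourth_moment (convolution_power rho n).
Proof.
move=> rho4; elim: n => [|n IH] /=; last exact: finite_fourth_moment_convolution.
rewrite /finite_fourth_moment /fourth_moment integral_dirac//.
  by rewrite diracT mul1e ltry.
exact/measurable_EFinP.
Qed.

(* Exchangeability of the summands: each of the n copies contributes equally
   to E[X f(X)]. *)
Lemma moment_leave_one_out rho n (f : measurableTypeR R -> R) :
  finite_fourth_moment rho -> lgrowth 3 f ->
  \int[convolution_power rho n]_x (x * f x) = n%:R *
    \int[rho]_y (y * \int[convolution_power rho n.-1]_w f (y + w)).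
Proof.
move=> rho4; have cp_fin m := finite_fourth_moment_convolution_power _ m rho4.
have gid : pgrowth 1 (fun p : R * R => p.1) := pgrowth_fst _ _ lgrowth_id.
have gid2 : pgrowth 1 (fun p : R * R => p.2) := pgrowth_snd _ _ lgrowth_id.
elim: n f => [|n IH] f gf.
  rewrite /= mul0r /Rintegral integral_dirac//.
    by rewrite diracT mul1e /= mul0r.
  apply/measurable_EFinP/measurable_funM => //; by case: gf.
rewrite [convolution_power rho n.+1]/= (@Rintegral_convolution _ _ _ 4)//; last first.
  exact: growthM _ 1 3 _ _ lgrowth_id gf.
have gfa := pgrowth_add _ _ gf.
under eq_Rintegral do rewrite mulrDl.
have g1 : pgrowth 4 (fun p : R * R => p.1 * f (p.1 + p.2)).
  exact: growthM _ 1 3 _ _ gid gfa.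
have g2 : pgrowth 4 (fun p : R * R => p.2 * f (p.1 + p.2)).
  exact: growthM _ 1 3 _ _ gid2 gfa.
rewrite RintegralD//; [|exact: (pgrowth_integrable _ _ 4)..].
rewrite !(@Rintegral_prod _ _ _ 4)//=.
rewrite -[n.+1]addn1 natrD mulrDl mul1r addrC; congr (_ + _); last first.
  apply: eq_Rintegral => y _; rewrite RintegralZl//.
  by apply: (lgrowth_integrable _ 3) => //; exact: pgrowth_section _ _ y gfa.
(* The part of the sum carried by the other [n] summands: the induction hypothesis for [f] shifted
   by the first summand [y]. *)
transitivity (\int[rho]_y (n%:R * \int[rho]_y' (y' *
   \int[convolution_power rho n.-1]_w f (y' + y + w)))).
  apply: eq_Rintegral => y _; rewrite IH; last exact: pgrowth_section _ _ y gfa.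
  congr (_ * _); apply: eq_Rintegral => y' _; congr (_ * _).
  by apply: eq_Rintegral => w _; rewrite addrCA addrA.
(* With no other summand both sides have the factor 0; otherwise the predecessor in [n.-1] is a
   genuine one. *)
case: n IH gfa g1 g2 => [|n] IH gfa g1 g2.
  by rewrite mul0r; under eq_Rintegral do rewrite mul0r; rewrite Rintegral_cst// mul0r.
pose G (s : measurableTypeR R) := \int[convolution_power rho n]_w f (s + w).
have gG : lgrowth 3 G.
  exact: (lgrowth_Rintegral _ 3 (fun p => f (p.1 + p.2)) (cp_fin n) isT gfa).
have gGa : pgrowth 4 (fun p : R * R => p.2 * G (p.2 + p.1)).
  under eq_fun do rewrite addrC.
  exact: growthM _ 1 3 _ _ gid2 (pgrowth_add _ _ gG).
rewrite RintegralZl//; last first.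
  apply: (lgrowth_integrable _ 4) => //.
  exact: (lgrowth_Rintegral rho 4 _ rho4 isT gGa).
congr (_ * _).
(* Exchangeability proper: Fubini in both orders swaps the two copies of [rho]; the one left inside
   [G] is then absorbed into the convolution power. *)
have := Rintegral_prod _ _ _ _ rho4 rho4 (isT : (4 <= 4)%N) gGa.
rewrite (Rintegral_prod2 _ _ _ _ rho4 rho4 (isT : (4 <= 4)%N) gGa) => <-.
apply: eq_Rintegral => y _ /=; rewrite RintegralZl//; last first.
  apply: (lgrowth_integrable _ 3) => //.
  exact: (pgrowth_section _ _ y (pgrowth_add _ _ gG)).
congr (_ * _).
have gfy : lgrowth 3 (fun x => f (y + x)) by exact: pgrowth_section _ _ y gfa.
rewrite (@Rintegral_convolution _ _ _ 3)//.
rewrite (@Rintegral_prod _ _ _ 3)//; last exact: (pgrowth_add 3 _ gfy).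
apply: eq_Rintegral => x _; apply: eq_Rintegral => w _ /=.
by rewrite addrA.
Qed.

End FourthMoment.

(** * Leave-one-out moments and concentration *)

Section Moments.
Context {R : realType}.
Implicit Types (rho nu mu : law R).

Lemma lgrowth_pow k : lgrowth k (fun x : R => x ^+ k).
Proof. by rewrite -[X in lgrowth X]mul1n; apply: growthX; exact: lgrowth_id. Qed.

Lemma lgrowthW j k (f : R -> R) : (j <= k)%N -> lgrowth j f -> lgrowth k f.
Proof. by move=> jk; apply: growthW => //; exact: weight_ge1. Qed.

Lemma pgrowthW j k (f : R * R -> R) : (j <= k)%N -> pgrowth j f -> pgrowth k f.
Proof. by move=> jk; apply: growthW => //; exact: weight2_ge1. Qed.

Lemma Rintegral_law_cst mu (c : R) : \int[mu]_x c = c.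
Proof. by rewrite Rintegral_cst// [X in fine X](probability_setT mu) mulr1. Qed.

Definition moment mu (k : nat) : R := \int[mu]_x (x : R) ^+ k.

Let monomial_growth k (r : R) : (k <= 4)%N -> lgrowth 4 (fun x : R => r * x ^+ k).
Proof.
by move=> k4; apply: (lgrowthW k) => //; apply: growthZ; exact: lgrowth_pow.
Qed.

Let quadratic_growth (a b c : R) :
  lgrowth 4 (fun x : R => a + b * x + c * x ^+ 2).
Proof.
apply: growthD (monomial_growth 2 c isT).
apply: growthD (monomial_growth 1 b isT).
by apply: (lgrowthW 0) => //; exact: growth_cst.
Qed.

Lemma lgrowth_quartic (a b c d e : R) :
  lgrowth 4 (fun x : R => a + b * x + c * x ^+ 2 + d * x ^+ 3 + e * x ^+ 4).
Proof.
apply: growthD (monomial_growth 4 e isT).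
exact: growthD (quadratic_growth a b c) (monomial_growth 3 d isT).
Qed.

(** Later moment computations are padded with zero coefficients to this shape, so that integrability
    of the powers is checked once. *)
Lemma Rintegral_quartic mu (a b c d e : R) : finite_fourth_moment mu ->
  \int[mu]_x (a + b * (x : R) + c * x ^+ 2 + d * x ^+ 3 + e * x ^+ 4) =
  a + b * moment mu 1 + c * moment mu 2 + d * moment mu 3 + e * moment mu 4.
Proof.
move=> mu4.
have g := monomial_growth.
have g0 : lgrowth 4 (fun=> a).
  by apply: (lgrowthW 0) => //; exact: growth_cst.
have i (f : R -> R) : lgrowth 4 f -> mu.-integrable setT (EFin \o f).
  exact: lgrowth_integrable.
have g1 := growthD _ _ _ _ g0 (g 1%N b isT).
have g2 := growthD _ _ _ _ g1 (g 2%N c isT).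
have g3 := growthD _ _ _ _ g2 (g 3%N d isT).
have ip k : (k <= 4)%N -> mu.-integrable setT (EFin \o (fun x : R => x ^+ k)).
  by move=> k4; apply: i; apply: (lgrowthW k) => //; exact: lgrowth_pow.
rewrite RintegralD//; [|exact: i|exact: i (g 4%N e isT)].
rewrite RintegralD//; [|exact: i|exact: i (g 3%N d isT)].
rewrite RintegralD//; [|exact: i|exact: i (g 2%N c isT)].
rewrite RintegralD//; [|exact: i|exact: i (g 1%N b isT)].
rewrite Rintegral_law_cst (@RintegralZl _ _ _ mu setT (fun x => x) b) ?(ip 1%N)//.
by rewrite !RintegralZl// ?ip.
Qed.

Context (rho : law R) (rho4 : finite_fourth_moment rho).
Let cp n := convolution_power rho n.
Let cp_fin n : finite_fourth_moment (cp n).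
Proof. exact: finite_fourth_moment_convolution_power. Qed.
Let lo k n (k3 : (k <= 3)%N) : moment (cp n) k.+1 =
  n%:R * \int[rho]_y (y * \int[cp n.-1]_w (y + w : R) ^+ k).
Proof.
rewrite -(moment_leave_one_out rho n (fun x => x ^+ k))//.
  by apply: eq_Rintegral => x _; rewrite exprS.
by apply: (lgrowthW k) => //; exact: lgrowth_pow.
Qed.

Lemma moment1_convolution_power n : moment (cp n) 1 = n%:R * moment rho 1.
Proof.
rewrite lo//; congr (_ * _); apply: eq_Rintegral => y _.
by under eq_Rintegral do rewrite expr0; rewrite Rintegral_law_cst mulr1 expr1.
Qed.

Hypothesis rho1 : moment rho 1 = 0.

Lemma centered_convolution_power n : moment (cp n) 1 = 0.
Proof. by rewrite moment1_convolution_power rho1 mulr0. Qed.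

Lemma moment2_convolution_power n : moment (cp n) 2 = n%:R * moment rho 2.
Proof.
rewrite lo//; congr (_ * _).
transitivity (\int[rho]_y (0 + 0 * (y : R) + 1 * y ^+ 2 + 0 * y ^+ 3 + 0 * y ^+ 4)); last first.
  by rewrite Rintegral_quartic// rho1; ring.
apply: eq_Rintegral => y _.
transitivity (y * \int[cp n.-1]_x (y + 1 * (x : R) + 0 * x ^+ 2 + 0 * x ^+ 3 + 0 * x ^+ 4)).
  by congr (_ * _); apply: eq_Rintegral => x _; ring.
by rewrite Rintegral_quartic// centered_convolution_power; ring.
Qed.

(** Leave-one-out with f = x^3: in the expansion of E[Y (Y + W)^3] the terms with E W and E Y
    vanish, leaving E Y^4 + 3 E Y^2 E W^2 with E W^2 = n E Y^2. *)
Lemma moment4_convolution_power n : moment (cp n.+1) 4 =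
  n.+1%:R * (moment rho 4 + 3 * n%:R * moment rho 2 ^+ 2).
Proof.
rewrite lo//; congr (_ * _) => /=.
transitivity (\int[rho]_y (0 + moment (cp n) 3 * (y : R) +
    3 * n%:R * moment rho 2 * y ^+ 2 + 0 * y ^+ 3 + 1 * y ^+ 4)); last first.
  by rewrite Rintegral_quartic// rho1; ring.
apply: eq_Rintegral => y _.
transitivity (y * \int[cp n]_x (y ^+ 3 + 3 * y ^+ 2 * (x : R) +
    3 * y * x ^+ 2 + 1 * x ^+ 3 + 0 * x ^+ 4)).
  by congr (_ * _); apply: eq_Rintegral => x _; ring.
rewrite Rintegral_quartic// centered_convolution_power moment2_convolution_power.
by ring.
Qed.

Lemma Rintegral_prodM nu j k (f g : R -> R) : finite_fourth_moment nu -> (j + k <= 4)%N ->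
  lgrowth j f -> lgrowth k g ->
  \int[(rho \x nu)%E]_p (f p.1 * g p.2) = \int[rho]_x f x * \int[nu]_x g x.
Proof.
move=> nu4 jk gf gg.
rewrite (@Rintegral_prod _ _ _ (j + k))//; last first.
  exact: growthM _ _ _ _ _ (pgrowth_fst _ _ gf) (pgrowth_snd _ _ gg).
have k4 : (k <= 4)%N by apply: leq_trans jk; exact: leq_addl.
have j4 : (j <= 4)%N by apply: leq_trans jk; exact: leq_addr.
rewrite -RintegralZr//; last exact: (lgrowth_integrable _ j).
apply: eq_Rintegral => x _ /=.
by rewrite RintegralZl//; exact: (lgrowth_integrable _ k).
Qed.

(** Independence and E Y = 0 give E[Y f(W)] = 0, so f(W) may be subtracted; the integrand becomes an
    increment of f over a shift by Y. *)
Lemma leave_one_out_difference n (f : R -> R) : lgrowth 3 f ->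
  \int[cp n.+1]_x (x * f x) =
  n.+1%:R * \int[(rho \x cp n)%E]_p (p.1 * (f (p.1 + p.2) - f p.2)).
Proof.
move=> gf; rewrite moment_leave_one_out//=; congr (_ * _).
have ga := pgrowth_add _ _ gf; have gs := pgrowth_snd _ _ gf.
have gid : pgrowth 1 (fun p : R * R => p.1) := pgrowth_fst _ _ lgrowth_id.
under [RHS]eq_Rintegral do rewrite mulrBr.
have g1 : pgrowth 4 (fun p : R * R => p.1 * f (p.1 + p.2)).
  exact: growthM _ 1 3 _ _ gid ga.
have g2 : pgrowth 4 (fun p : R * R => p.1 * f p.2).
  exact: growthM _ 1 3 _ _ gid gs.
rewrite RintegralB//; [|exact: (pgrowth_integrable _ _ 4)..].
rewrite (Rintegral_prodM (cp n) 1 3 (fun x => x) f (cp_fin n) isT lgrowth_id gf).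
have -> : \int[rho]_x x = 0.
  by rewrite -rho1; apply: eq_Rintegral => x _; rewrite expr1.
rewrite mul0r subr0 (@Rintegral_prod _ _ _ 4)//=.
apply: eq_Rintegral => y _; rewrite RintegralZl//.
by apply: (lgrowth_integrable _ 3) => //; exact: pgrowth_section _ _ y ga.
Qed.

End Moments.

(** * Concentration of the sum with one summand removed *)

Section Concentration.
Context {R : realType}.

Definition clip (M x : R) : R := Num.max (- M) (Num.min M x).

Lemma clip_le M x : 0 <= M -> `|clip M x| <= M.
Proof.
move=> M0; rewrite ler_norml /clip le_max lexx/= ge_max ge_min lexx/= andbT.
lra.
Qed.

Lemma clip_id M x : `|x| <= M -> clip M x = x.
Proof. by rewrite ler_norml => /andP[Mx xM]; rewrite /clip min_r// max_r. Qed.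

Lemma clip_homo M x y : x <= y -> clip M x <= clip M y.
Proof.
by move=> xy; rewrite /clip le_max2// le_min2.
Qed.

(** This sign agreement allows the contribution of large summands to be discarded from a lower
    bound. *)
Lemma clip_monotone M x y : 0 <= y * (clip M (x + y) - clip M x).
Proof.
have [y0|/ltW y0] := leP 0 y.
  by rewrite mulr_ge0// subr_ge0 clip_homo// lerDl.
by rewrite mulr_le0// subr_le0 clip_homo// gerDl.
Qed.

Context (rho : law R) (rho4 : finite_fourth_moment rho) (rho1 : moment rho 1 = 0).
Context (n : nat) (rho2 : n.+1%:R * moment rho 2 = 1).
Let nu := convolution_power rho n.
Let nu4 : finite_fourth_moment nu.
Proof. exact: finite_fourth_moment_convolution_power. Qed.
Let mu := convolution_power rho n.+1.
Let mu4 : finite_fourth_moment mu.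
Proof. exact: finite_fourth_moment_convolution_power. Qed.

(* Test the leave-one-out identity on a clipped linear function with slope 1
   near [a, b]: only summands smaller than 2t need to be controlled there. *)
Lemma concentration (t a b : R) : 0 < t ->
  n.+1%:R * moment rho 4 <= t ^+ 2 -> a <= b ->
  \int[nu]_w (\1_`[a, b] w : R) <= b - a + 4 * t.
Proof.
move=> t0 m4t ab.
(* The clipping starts 2t beyond the ends of [a, b], so [f] has slope 1 along any shift of size at
   most 2t from a point of [a, b]. *)
pose M := (b - a) / 2 + 2 * t; have M0 : 0 <= M by rewrite /M; lra.
pose f (x : R) := clip M (x - (a + b) / 2).
(* A polynomial minorant of y^2 restricted to |y| <= 2t: it is at most y^2 everywhere and
   nonpositive beyond 2t. Its integral involves moments only, and N E g(Y) >= 1 - 1/4. *)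
pose g (x : R) := x ^+ 2 - (4 * t ^+ 2)^-1 * x ^+ 4.
have mf : measurable_fun [set: R] f.
  apply: measurable_maxr; first exact: measurable_cst.
  by apply: measurable_minr; [exact: measurable_cst|exact: measurable_funB].
have gf : lgrowth 3 f.
  apply: (lgrowthW 0) => //; apply: (growth_bounded _ M) => //.
  by move=> x; exact: clip_le.
have gg : lgrowth 4 g.
  apply: growthB; first by apply: (lgrowthW 2) => //; exact: lgrowth_pow.
  by apply: growthZ; exact: lgrowth_pow.
have gI : lgrowth 0 (\1_`[a, b] : R -> R).
  apply: (growth_bounded _ 1); first exact: measurable_indic.
  by move=> x; rewrite indicE; case: (_ \in _); rewrite ?normr1 ?normr0 ?ler01.
have upper : \int[mu]_x (x * f x) <= M.
  have -> : M = \int[mu]_x (M / 2 + 0 * (x : R) + M / 2 * x ^+ 2 + 0 * x ^+ 3 + 0 * x ^+ 4).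
    rewrite Rintegral_quartic//.
    by rewrite moment2_convolution_power// rho2; field.
  apply: le_Rintegral => //.
  - apply: (lgrowth_integrable _ 4) => //.
    exact: growthM _ 1 3 _ _ lgrowth_id gf.
  - by apply: (lgrowth_integrable _ 4) => //; exact: lgrowth_quartic.
  - move=> x _; apply: (le_trans (ler_norm _)); rewrite normrM.
    have := clip_le M (x - (a + b) / 2) M0; rewrite -/(f x) => fM.
    have xx : `|x| <= (1 + x ^+ 2) / 2.
      rewrite -(real_normK (num_real x)); have := sqr_ge0 (`|x| - 1); nra.
    have : `|x| * `|f x| <= (1 + x ^+ 2) / 2 * M by apply: ler_pM.
    lra.
have pointwise (y w : R) : g y * \1_`[a, b] w <= y * (f (y + w) - f w).
  have mono : 0 <= y * (f (y + w) - f w).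
    rewrite /f [y + w]addrC -addrA [y - _]addrC addrA.
    exact: clip_monotone.
  rewrite indicE; have [/set_mem/=|_] := boolP (w \in _); last by rewrite mulr0.
  rewrite in_itv/= mulr1 => /andP[aw wb].
  have [yt|yt] := leP (`|y|) (2 * t).
    have -> : f (y + w) - f w = y.
      rewrite /f !clip_id; first by ring.
        rewrite ler_norml /M; move: aw wb t0; lra.
      move: yt; rewrite !ler_norml /M; lra.
    by rewrite -expr2 /g gerBl mulr_ge0 ?exprn_even_ge0// invr_ge0 mulr_ge0 ?sqr_ge0.
  apply: le_trans mono.
  have -> : g y = y ^+ 2 * (1 - (4 * t ^+ 2)^-1 * y ^+ 2) by rewrite /g; ring.
  rewrite mulr_ge0_le0 ?sqr_ge0// subr_le0 mulrC ler_pdivlMr; last by nra.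
  rewrite mul1r -(real_normK (num_real y)); nra.
have lower : n.+1%:R * (\int[rho]_y g y * \int[nu]_w \1_`[a, b] w) <=
    \int[mu]_x (x * f x).
  rewrite leave_one_out_difference// ler_pM2l ?ltr0n//.
  rewrite -(Rintegral_prodM rho rho4 nu 4 0 g _ nu4 isT gg gI).
  apply: le_Rintegral => //.
  - apply: (pgrowth_integrable _ _ 4) => //.
    exact: growthM _ 4 0 _ _ (pgrowth_fst _ _ gg) (pgrowth_snd _ _ gI).
  - apply: (pgrowth_integrable _ _ 4) => //.
    apply: (growthM _ 1 3); first exact: (pgrowth_fst 1 _ lgrowth_id).
    by apply: growthB; [exact: (pgrowth_add _ _ gf)|exact: (pgrowth_snd _ _ gf)].
have gE : \int[rho]_y g y = moment rho 2 - (4 * t ^+ 2)^-1 * moment rho 4.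
  transitivity (\int[rho]_y (0 + 0 * (y : R) + 1 * y ^+ 2 + 0 * y ^+ 3 +
      (- (4 * t ^+ 2)^-1) * y ^+ 4)).
    by apply: eq_Rintegral => y _; rewrite /g; ring.
  by rewrite Rintegral_quartic//; ring.
set p := \int[nu]_w _ in lower *.
have p0 : 0 <= p by apply: Rintegral_ge0 => x _; rewrite indicE; case: (_ \in _).
(* Then p <= 4M/3 = 2(b - a)/3 + 8t/3, which is below the announced bound. *)
have : 3 / 4 * p <= M.
  apply: le_trans upper; apply: le_trans lower; rewrite mulrA ler_wpM2r//.
  rewrite gE mulrBr rho2.
  have : (4 * t ^+ 2)^-1 * (n.+1%:R * moment rho 4) <= 1 / 4.
    rewrite mulrC ler_pdivrMr; last by nra.
    lra.
  lra.
rewrite -/p /M; lra.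
Qed.

End Concentration.

(** * Comparison with the normal law *)

Section Estimate.
Context {R : realType}.

Lemma ramp_nonincreasing (z s x y : R) : 0 < s -> x <= y ->
  ramp z s y <= ramp z s x.
Proof.
move=> s0 xy; rewrite /ramp le_max2// le_min2// ler_pM2r ?invr_gt0//; lra.
Qed.

Let K : R := 1 + (normal_pdf 0 1 (1 : R))^-1.

Section SteinIncrement.
Context (f h : R -> R) (c : R).
Let df (x : R) := x * f x + (h x - c).
Hypothesis f_derive : forall x : R, is_derive x 1 f (df x).
Hypothesis h_nonincreasing : forall x y : R, x <= y -> h y <= h x.
Hypothesis hc_le1 : forall x : R, `|h x - c| <= 1.
Hypothesis f_le : forall x : R, `|f x| <= K.
Hypothesis xf_le : forall x : R, `|x * f x| <= 1.

Lemma stein_derivative_le2 x : `|df x| <= 2.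
Proof.
apply: (le_trans (ler_normD _ _)); have := xf_le x; have := hc_le1 x; lra.
Qed.

(** The oscillation of the nonincreasing [h] on the interval of radius [|y|] around [w]; it serves
    for every shift of size at most [|y|]. *)
Let H (y w : R) : R := h (w - `|y|) - h (w + `|y|).

(** The increment of x f splits into w (f(w + u) - f(w)) and u f(w + u), bounded through |f'| <= 2
    and |f| <= K. That of [h] is left as an oscillation, so that no slope of [h] appears. *)
Lemma stein_derivative_increment (w u y : R) : `|u| <= `|y| ->
  `|df (w + u) - df w| <= (K + 2 * `|w|) * `|y| + H y w.
Proof.
move=> uy; have [v _ fv] := mean_value f df w u f_derive.
have -> : df (w + u) - df w =
    (w * (df (w + v) * u) + u * f (w + u)) + (h (w + u) - h w).
  by rewrite -fv /df; ring.
apply: (le_trans (ler_normD _ _)); apply: lerD.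
  apply: (le_trans (ler_normD _ _)).
  have b1 : `|w * (df (w + v) * u)| <= `|w| * (2 * `|y|).
    by rewrite !normrM ler_wpM2l// ler_pM// stein_derivative_le2.
  have b2 : `|u * f (w + u)| <= `|y| * K by rewrite normrM ler_pM.
  lra.
move: uy; rewrite ler_norml => /andP[uy1 uy2].
have y0 : 0 <= `|y| by [].
have h1 : h (w + u) <= h (w - `|y|) by apply: h_nonincreasing; lra.
have h2 : h (w + `|y|) <= h (w + u) by apply: h_nonincreasing; lra.
have h3 : h w <= h (w - `|y|) by apply: h_nonincreasing; lra.
have h4 : h (w + `|y|) <= h w by apply: h_nonincreasing; lra.
rewrite /H ler_norml; apply/andP; split; lra.
Qed.

(** The term with the factor [N * y ^+ 2 - 1] integrates to 0, as N E Y^2 = 1. Adding it leaves f'(w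
    + y) - f'(w) minus N y^2 times an increment of f' at w over a shift no longer than |y|, hence
    the weight 1 + N y^2. *)
Lemma stein_increment (N y w : R) : 0 <= N ->
  `|df (y + w) + (N * y ^+ 2 - 1) * df w - N * (y * (f (y + w) - f w))| <=
  (1 + N * y ^+ 2) * ((K + 2 * `|w|) * `|y| + H y w).
Proof.
move=> N0; have [v vy fv] := mean_value f df w y f_derive.
rewrite [y + w]addrC fv.
have -> : df (w + y) + (N * y ^+ 2 - 1) * df w - N * (y * (df (w + v) * y)) =
    (df (w + y) - df w) - N * y ^+ 2 * (df (w + v) - df w) by ring.
apply: (le_trans (ler_normB _ _)); rewrite mulrDl mul1r; apply: lerD.
  exact: stein_derivative_increment.
have Ny : 0 <= N * y ^+ 2 by rewrite mulr_ge0 ?sqr_ge0.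
by rewrite normrM (ger0_norm Ny) ler_wpM2l// stein_derivative_increment.
Qed.

End SteinIncrement.

Context (rho : law R) (rho4 : finite_fourth_moment rho) (rho1 : moment rho 1 = 0).
Context (n : nat) (rho2 : n.+1%:R * moment rho 2 = 1).
Let N : R := n.+1%:R.
Let N0 : 0 <= N. Proof. exact: ler0n. Qed.
Let nu := convolution_power rho n.
Let nu4 : finite_fourth_moment nu.
Proof. exact: finite_fourth_moment_convolution_power. Qed.
Let mu := convolution_power rho n.+1.
Let mu4 : finite_fourth_moment mu.
Proof. exact: finite_fourth_moment_convolution_power. Qed.
Context (t : R) (t0 : 0 < t) (Nt : 1 <= N * t ^+ 2).
Hypothesis m4t : N * moment rho 4 <= t ^+ 2.

Let q (y : R) : R := (1 + N * y ^+ 2) * `|y|.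
Let r (y : R) : R := 1 + N * y ^+ 2.

Let gr : lgrowth 2 r.
Proof.
apply: growthD; first by apply: (lgrowthW 0) => //; exact: growth_cst.
by apply: growthZ; exact: lgrowth_pow.
Qed.

Let gnorm : lgrowth 1 (fun x : R => `|x|).
Proof. exact: growth_norm lgrowth_id. Qed.

Let gq : lgrowth 3 q.
Proof. exact: growthM _ 2 1 _ _ gr gnorm. Qed.

Let rhoint k (f : R -> R) : (k <= 4)%N -> lgrowth k f ->
  rho.-integrable setT (EFin \o f).
Proof. by move=> k4 gf; exact: (lgrowth_integrable _ k). Qed.

Let int_r : \int[rho]_y r y = 2.
Proof.
transitivity (\int[rho]_y (1 + 0 * (y : R) + N * y ^+ 2 + 0 * y ^+ 3 + 0 * y ^+ 4)).
  by apply: eq_Rintegral => y _; rewrite /r; ring.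
by rewrite Rintegral_quartic// rho2; ring.
Qed.

(** The inequality |y| <= t/2 + y^2/(2t), multiplied by 1 + N y^2, controls E|Y| and N E|Y|^3
    together. Each of the four resulting terms is at most t/2, by E Y^2 = 1/N <= t^2 and N E Y^4 <=
    t^2. *)
Let int_q : \int[rho]_y q y <= 2 * t.
Proof.
have tn0 : t != 0 by rewrite gt_eqF.
apply: (@le_trans _ _ (\int[rho]_y (t / 2 + 0 * (y : R) + (t^-1 / 2 + N * t / 2) * y ^+ 2
    + 0 * y ^+ 3 + (N * t^-1 / 2) * y ^+ 4))).
  apply: le_Rintegral => //; first exact: (rhoint 3).
    by apply: (rhoint 4) => //; exact: lgrowth_quartic.
  move=> y _; rewrite /q.
  have -> : y ^+ 4 = `|y| ^+ 4 by rewrite -normrX ger0_norm// exprn_even_ge0.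
  rewrite -(real_normK (num_real y)); move: `|y| (normr_ge0 y) => a a0.
  rewrite -subr_ge0.
  have -> : t / 2 + 0 * y + (t^-1 / 2 + N * t / 2) * a ^+ 2 + 0 * y ^+ 3 +
     N / t / 2 * a ^+ 4 - (1 + N * a ^+ 2) * a =
     t^-1 / 2 * (1 + N * a ^+ 2) * (a - t) ^+ 2 by field.
  by rewrite mulr_ge0 ?sqr_ge0// mulr_ge0 ?divr_ge0 ?invr_ge0
    ?addr_ge0 ?mulr_ge0 ?sqr_ge0// ltW.
rewrite Rintegral_quartic// rho1.
have e1 : t^-1 * moment rho 2 <= t.
  rewrite mulrC ler_pdivrMr// -expr2.
  have Np : 0 < N by rewrite ltr0n.
  by rewrite -(ler_pM2l Np) rho2.
have e2 : t^-1 * (N * moment rho 4) <= t.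
  by rewrite mulrC ler_pdivrMr// -expr2.
have e3 : N * t / 2 * moment rho 2 = t / 2.
  rewrite (_ : N * t / 2 * moment rho 2 = (N * moment rho 2) * t / 2); last by ring.
  by rewrite [N * moment rho 2]rho2 mul1r.
rewrite mulrDl e3; move: e1 e2; rewrite /N; lra.
Qed.

Let int_norm_nu : \int[nu]_w `|w| <= 1.
Proof.
have m2 : 0 <= moment rho 2 by apply: Rintegral_ge0 => x _; exact: sqr_ge0.
apply: (@le_trans _ _ (\int[nu]_y (1 / 2 + 0 * (y : R) + 1 / 2 * y ^+ 2
    + 0 * y ^+ 3 + 0 * y ^+ 4))).
  apply: le_Rintegral => //.
  - exact: (lgrowth_integrable _ 1).
  - by apply: (lgrowth_integrable _ 4) => //; exact: lgrowth_quartic.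
  - move=> x _; rewrite -(real_normK (num_real x)).
    have := sqr_ge0 (`|x| - 1); nra.
rewrite Rintegral_quartic// moment2_convolution_power//.
move: rho2; rewrite -natr1 mulrDl; lra.
Qed.

(** The constant collects 2K from |f| <= K, 4 from the term with |w|, and 10 + 4 from the
    oscillation of the ramp, using that [r] has mean 2, [q] mean at most 2t, and E|W| <= 1. *)
Lemma ramp_estimate (z : R) : exists2 c : R, Phi z <= c <= Phi z + t &
  `|\int[mu]_x ramp z t x - c| <= (2 * K + 18) * t.
Proof.
have [c [f [cz df_f hc1 fK xf1]]] := stein_ramp z t t0.
exists c => //.
pose h := ramp z t; pose df (x : R) := x * f x + (h x - c).
pose H (y w : R) : R := h (w - `|y|) - h (w + `|y|).
have hmono (x y : R) : x <= y -> h y <= h x by exact: ramp_nonincreasing.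
have df2 (x : R) : `|df x| <= 2 by exact: stein_derivative_le2.
have mh : measurable_fun [set: R] h.
  by apply: continuous_measurable_fun; exact: ramp_continuous.
have mf : measurable_fun [set: R] f.
  apply: continuous_measurable_fun.
  exact: derivable_everywhere_continuous _ _ df_f.
have gf : lgrowth 0 f by exact: (growth_bounded _ K).
have gdf : lgrowth 0 df.
  apply: (growth_bounded _ 2) => //; apply: measurable_funD.
    by apply: measurable_funM => //; exact: measurable_id.
  by apply: measurable_funB => //; exact: measurable_cst.
have gxf : lgrowth 1 (fun x => x * f x) := growthM _ 1 0 _ _ lgrowth_id gf.
have gf3 : lgrowth 3 f by apply: lgrowthW gf.
have muint k (g : R -> R) : (k <= 4)%N -> lgrowth k g ->
    mu.-integrable setT (EFin \o g).
  by move=> k4 gg; exact: (lgrowth_integrable _ k).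
have hE : \int[mu]_x h x = \int[mu]_x df x - \int[mu]_x (x * f x) + c.
  rewrite -RintegralB//; [|exact: (muint 0)|exact: (muint 1)].
  rewrite -[X in _ = _ + X](Rintegral_law_cst mu) -RintegralD//.
  - by apply: eq_Rintegral => x _; rewrite /df; ring.
  - by apply: (muint 1) => //; apply: growthB => //; exact: lgrowthW gdf.
  - by apply: (muint 0) => //; exact: growth_cst.
pose T (p : R * R) := df (p.1 + p.2) + (N * p.1 ^+ 2 - 1) * df p.2 -
  N * (p.1 * (f (p.1 + p.2) - f p.2)).
have gc : lgrowth 2 (fun y : R => N * y ^+ 2 - 1).
  apply: growthB; first by apply: growthZ; exact: lgrowth_pow.
  by apply: (lgrowthW 0) => //; exact: growth_cst.
have g1 : pgrowth 4 (fun p => df (p.1 + p.2)).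
  by apply: (pgrowthW 0) => //; exact: (pgrowth_add _ _ gdf).
have g2 : pgrowth 4 (fun p => (N * p.1 ^+ 2 - 1) * df p.2).
  apply: (pgrowthW (2 + 0)) => //.
  exact: growthM _ 2 0 _ _ (pgrowth_fst _ _ gc) (pgrowth_snd _ _ gdf).
have g3 : pgrowth 4 (fun p => N * (p.1 * (f (p.1 + p.2) - f p.2))).
  apply: growthZ; apply: (growthM _ 1 3); first exact: (pgrowth_fst 1 _ lgrowth_id).
  by apply: growthB; [exact: (pgrowth_add _ _ gf3)|exact: (pgrowth_snd _ _ gf3)].
have g12 : pgrowth 4 (fun p => df (p.1 + p.2) + (N * p.1 ^+ 2 - 1) * df p.2).
  exact: growthD.
have gT : pgrowth 4 T by exact: growthB.
have pint k (F : R * R -> R) : (k <= 4)%N -> pgrowth k F ->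
    (rho \x nu)%E.-integrable setT (EFin \o F).
  by move=> k4 gF; exact: (pgrowth_integrable _ _ k).
(* Of the three terms of [T], the first gives E f'(X), the second 0, and the third E[X f(X)] by
   leave-one-out. *)
have -> : \int[mu]_x h x - c = \int[(rho \x nu)%E]_p T p.
  have i12 := pint 4%N _ isT g12; have i3 := pint 4%N _ isT g3.
  have i1 := pint 4%N _ isT g1; have i2 := pint 4%N _ isT g2.
  rewrite hE addrK /T [in RHS]RintegralB// [in RHS]RintegralD//.
  have -> : \int[(rho \x nu)%E]_p ((N * p.1 ^+ 2 - 1) * df p.2) =
      \int[rho]_y (N * y ^+ 2 - 1) * \int[nu]_w df w.
    exact: (Rintegral_prodM rho rho4 nu 2 0 _ df nu4 isT gc gdf).
  have -> : \int[rho]_y (N * y ^+ 2 - 1) = 0.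
    transitivity (\int[rho]_y (- 1 + 0 * (y : R) + N * y ^+ 2 + 0 * y ^+ 3 + 0 * y ^+ 4)).
      by apply: eq_Rintegral => y _; ring.
    by rewrite Rintegral_quartic// rho2; ring.
  rewrite mul0r addr0; congr (_ - _).
    exact: (Rintegral_convolution _ _ 0).
  rewrite leave_one_out_difference// RintegralZl//.
  apply: (pint 4) => //; apply: (growthM _ 1 3); first exact: (pgrowth_fst 1 _ lgrowth_id).
  by apply: growthB; [exact: (pgrowth_add _ _ gf3)|exact: (pgrowth_snd _ _ gf3)].
have gH : pgrowth 0 (fun p => H p.1 p.2).
  apply: (growth_bounded _ 1).
    apply: measurable_funB.
      apply: (measurableT_comp mh); apply: measurable_funB => //.
      by apply: measurableT_comp => //; exact: normr_measurable.
    apply: (measurableT_comp mh); apply: measurable_funD => //.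
    by apply: measurableT_comp => //; exact: normr_measurable.
  move=> p; rewrite /H ler_norml.
  have := ramp_ge0 z t (p.2 - `|p.1|); have := ramp_ge0 z t (p.2 + `|p.1|).
  have := ramp_le1 z t (p.2 - `|p.1|); have := ramp_le1 z t (p.2 + `|p.1|).
  rewrite -/h; lra.
have gqp : pgrowth 4 (fun p => K * q p.1).
  by apply: growthZ; apply: (pgrowthW 3) => //; exact: (pgrowth_fst _ _ gq).
have gqn : pgrowth 4 (fun p => q p.1 * (2 * `|p.2|)).
  by apply: (growthM _ 3 1); [exact: (pgrowth_fst _ _ gq)|
    apply: growthZ; exact: (pgrowth_snd _ _ gnorm)].
have grH : pgrowth 2 (fun p => r p.1 * H p.1 p.2).
  exact: growthM _ 2 0 _ _ (pgrowth_fst _ _ gr) gH.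
have grH4 : pgrowth 4 (fun p => r p.1 * H p.1 p.2) by apply: pgrowthW grH.
apply: (le_trans (le_normr_Rintegral _ _)) => //; first exact: (pint 4).
apply: (@le_trans _ _ (\int[(rho \x nu)%E]_p
   (K * q p.1 + q p.1 * (2 * `|p.2|) + r p.1 * H p.1 p.2))).
  apply: le_Rintegral => //.
  - by apply: (pint 4) => //; exact: growth_norm.
  - by apply: (pint 4) => //; apply: growthD => //; exact: growthD.
  - move=> [y w] _ /=.
    have := stein_increment f h c df_f hmono hc1 fK xf1 N y w N0.
    rewrite -/(df _) -/(df _) -/(H y w) /T /= => /le_trans; apply.
    by rewrite le_eqVlt; apply/orP; left; apply/eqP; rewrite /q /r; ring.
rewrite RintegralD//; [|by apply: (pint 4) => //; exact: growthD|exact: (pint 4)].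
rewrite RintegralD//; [|exact: (pint 4)..].
have -> : \int[(rho \x nu)%E]_p (K * q p.1) = K * \int[rho]_y q y.
  rewrite (@Rintegral_prod _ _ _ 4)// -RintegralZl//; last exact: (rhoint 3).
  apply: eq_Rintegral => y _ /=. exact: (Rintegral_law_cst nu).
have g2n : lgrowth 1 (fun x : R => 2 * `|x|) by exact: growthZ.
rewrite (Rintegral_prodM rho rho4 nu 3 1 q _ nu4 isT gq g2n).
rewrite RintegralZl//; last exact: (lgrowth_integrable _ 1).
have lastterm : \int[(rho \x nu)%E]_p (r p.1 * H p.1 p.2) <= 5 * t * 2 + 2 * \int[rho]_y q y.
  rewrite (@Rintegral_prod _ _ _ 2)// -[X in 5 * t * X]int_r -!RintegralZl//;
    [|exact: (rhoint 3)|exact: (rhoint 2)].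
  rewrite -RintegralD//;
    [|by apply: (rhoint 2) => //; exact: growthZ|by apply: (rhoint 3) => //; exact: growthZ].
  apply: le_Rintegral => //.
  - by apply: (rhoint 2) => //; exact: (lgrowth_Rintegral _ 2 _ nu4 isT grH).
  - apply: (rhoint 3) => //; apply: growthD; last exact: growthZ.
    by apply: growthZ; exact: lgrowthW gr.
  - move=> y _ /=.
    have gHy : lgrowth 0 (H y) := pgrowth_section _ _ y gH.
    have r0 : 0 <= r y by rewrite /r addr_ge0// mulr_ge0 ?sqr_ge0.
    rewrite RintegralZl//; last exact: (lgrowth_integrable _ 0).
    have y0 : 0 <= `|y| by [].
    (* [H y w] is at most 1, and it is 0 outside [z - |y|, z + t + |y|], where both evaluation
       points lie on the same flat side of the ramp; concentration then gives 5t + 2|y|. *)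
    have : \int[nu]_w H y w <= (z + t + `|y|) - (z - `|y|) + 4 * t.
      apply: (le_trans _ (concentration rho rho4 rho1 n rho2 t _ _ t0 m4t _)); last by lra.
      apply: le_Rintegral => //.
      + exact: (lgrowth_integrable _ 0).
      + apply: (lgrowth_integrable _ 0) => //; apply: (growth_bounded _ 1).
          exact: measurable_indic.
        by move=> x; rewrite indicE; case: (_ \in _); rewrite ?normr1 ?normr0 ?ler01.
      + move=> x _; rewrite indicE; case: (boolP (x \in _)) => [_|/negP xI].
          rewrite /H; have := ramp_ge0 z t (x + `|y|); have := ramp_le1 z t (x - `|y|).
          by rewrite -/h /=; lra.
        rewrite /H /h.
        have [xz|xz] := leP (x + `|y|) z.
          by rewrite !ramp_eq1 ?subrr//; lra.
        have [xz2|xz2] := leP (z + t) (x - `|y|).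
          by rewrite !ramp_eq0 ?subrr//; lra.
        exfalso; apply: xI; rewrite inE/= in_itv/=; apply/andP; split; lra.
    move=> Hy; apply: (@le_trans _ _ (r y * (5 * t + 2 * `|y|))).
      by rewrite ler_wpM2l//; lra.
    by rewrite le_eqVlt; apply/orP; left; apply/eqP; rewrite /q /r; ring.
have q0 : 0 <= \int[rho]_y q y.
  by apply: Rintegral_ge0 => y _; rewrite /q mulr_ge0// addr_ge0// mulr_ge0 ?sqr_ge0.
have K0 : 0 <= K by exact: le_trans (fK 0).
have e1 : K * \int[rho]_y q y <= K * (2 * t) by rewrite ler_wpM2l.
have e2 : (\int[rho]_y q y) * (2 * \int[nu]_w `|w|) <= 2 * t * 2.
  apply: ler_pM => //; first by rewrite mulr_ge0// Rintegral_ge0.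
  by move: int_norm_nu; lra.
move: lastterm int_q e1 e2; lra.
Qed.

End Estimate.

(** * From ramps to distribution functions, and the choice of N and t *)

Section Final.
Context {R : realType}.

(** The constant of [ramp_estimate], plus 1 for replacing an indicator by a ramp of width t. *)
Definition berry_esseen_cst : R := 2 * (1 + (normal_pdf 0 1 (1 : R))^-1) + 19.

Lemma berry_esseen_cst_gt0 : 0 < berry_esseen_cst.
Proof.
have : 0 <= (normal_pdf 0 1 (1 : R))^-1 by rewrite invr_ge0 normal_pdf_ge0.
by rewrite /berry_esseen_cst; lra.
Qed.

(** The ramps starting at [z - t] and at [z] bracket the indicator of []-oo, z]]; their Gaussian
    means differ from [Phi z] by at most t in the unfavourable direction. *)
Lemma cdf_estimate (rho : law R) (n : nat) (t z : R) :
  let mu := convolution_power rho n.+1 in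
  finite_fourth_moment rho -> moment rho 1 = 0 -> n.+1%:R * moment rho 2 = 1 ->
  0 < t -> 1 <= n.+1%:R * t ^+ 2 -> n.+1%:R * moment rho 4 <= t ^+ 2 ->
  `|Phi z - fine (mu `]-oo, z]%classic)| <= berry_esseen_cst * t.
Proof.
move=> mu rho4 rho1 rho2 t0 Nt m4t.
have mu4 : finite_fourth_moment mu by exact: finite_fourth_moment_convolution_power.
have muint (g : R -> R) : measurable_fun setT g -> (forall x, 0 <= g x <= 1) ->
    mu.-integrable setT (EFin \o g).
  move=> mg g1; apply: (lgrowth_integrable _ 0) => //.
  by apply: (growth_bounded _ 1) => // x; rewrite ger0_norm; have /andP[] := g1 x.
have rampint y : mu.-integrable setT (EFin \o ramp y t).
  apply: muint => [|x]; last by rewrite ramp_ge0 ramp_le1.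
  by apply: continuous_measurable_fun; exact: ramp_continuous.
have indint : mu.-integrable setT (EFin \o (\1_`]-oo, z] : R -> R)).
  apply: muint => [|x]; first exact: measurable_indic.
  by rewrite indicE; case: (_ \in _); rewrite lexx ler01.
have -> : fine (mu `]-oo, z]%classic) = \int[mu]_x \1_`]-oo, z] x.
  by rewrite /Rintegral integral_indic// setIT.
have [c1 /andP[_ c1P] e1] := ramp_estimate rho rho4 rho1 n rho2 t t0 Nt m4t z.
have [c2 /andP[c2P _] e2] := ramp_estimate rho rho4 rho1 n rho2 t t0 Nt m4t (z - t).
have l1 : \int[mu]_x \1_`]-oo, z] x <= \int[mu]_x ramp z t x.
  apply: le_Rintegral => // x _; rewrite indicE.
  case: (boolP (x \in _)) => [/set_mem/=|_]; last exact: ramp_ge0.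
  by rewrite in_itv/= => xz; rewrite ramp_eq1.
have l2 : \int[mu]_x ramp (z - t) t x <= \int[mu]_x \1_`]-oo, z] x.
  apply: le_Rintegral => // x _; rewrite indicE.
  case: (boolP (x \in _)) => [_|/negP xz]; first exact: ramp_le1.
  rewrite ramp_eq0//; rewrite leNgt; apply/negP => zx; apply: xz.
  rewrite inE/= in_itv/=; lra.
have := Phi_increment (z - t) t (ltW t0); rewrite subrK => l3.
move: e1 e2; rewrite -/mu !ler_norml /berry_esseen_cst mulrDl; lra.
Qed.

Lemma cdf_estimate_infinitely_divisible (mu : law R) (t z : R) :
  infinitely_divisible mu -> finite_fourth_moment mu ->
  moment mu 1 = 0 -> moment mu 2 = 1 ->
  0 < t -> moment mu 4 - 3 < t ^+ 2 ->
  `|Phi z - fine (mu `]-oo, z]%classic)| <= berry_esseen_cst * t.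
Proof.
move=> mu_id mu4 mu1 mu2 t0 m4t.
pose d := t ^+ 2 - (moment mu 4 - 3).
have d0 : 0 < d by rewrite subr_gt0.
have t20 : 0 < t ^+ 2 by rewrite exprn_gt0.
(* With N = n + 1, the first summand makes 3/N at most the slack [d], the second makes 1/N at most
   [t ^+ 2]. *)
pose n := Num.bound (3 / d + 1 / t ^+ 2).
have nP : 3 / d + 1 / t ^+ 2 < n.+1%:R.
  apply: lt_trans (_ : n%:R < _); last by rewrite ltr_nat.
  by apply: archi_boundP; rewrite addr_ge0// divr_ge0// ltW.
have N0 : 0 < n.+1%:R :> R by rewrite ltr0n.
have nd : 3 <= n.+1%:R * d.
  rewrite -ler_pdivrMr// (le_trans _ (ltW nP))// lerDl.
  by rewrite divr_ge0// ltW.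
have nt : 1 <= n.+1%:R * t ^+ 2.
  rewrite -ler_pdivrMr// (le_trans _ (ltW nP))// lerDr.
  by rewrite divr_ge0// ltW.
have [rho rhoE] := mu_id n.+1 isT.
have momentE k : moment mu k = moment (convolution_power rho n.+1) k.
  rewrite /moment /Rintegral; congr fine.
  by apply: eq_measure_integral => A mA _; exact: rhoE.
have cp_fin : finite_fourth_moment (convolution_power rho n.+1).
  move: mu4; rewrite /finite_fourth_moment /fourth_moment.
  by rewrite (eq_measure_integral (convolution_power rho n.+1)) // => A mA _; exact: rhoE.
have rho4 : finite_fourth_moment rho by exact: finite_fourth_moment_left cp_fin.
have rho1 : moment rho 1 = 0.
  apply/eqP; move: mu1; rewrite momentE moment1_convolution_power// => /eqP.
  by rewrite mulf_eq0 gt_eqF.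
have rho2 : n.+1%:R * moment rho 2 = 1.
  by move: mu2; rewrite momentE moment2_convolution_power.
rewrite rhoE//; apply: cdf_estimate => //.
have := momentE 4; rewrite moment4_convolution_power// => m4E.
(* The identity N E Y^4 = m_4 - 3 + 3/N, multiplied by N to avoid division. *)
have e : n.+1%:R * (n.+1%:R * moment rho 4) =
   n.+1%:R * moment mu 4 - 3 * n%:R.
  rewrite m4E.
  have -> : n.+1%:R * (n.+1%:R * (moment rho 4 + 3 * n%:R * moment rho 2 ^+ 2)) =
    n.+1%:R * (n.+1%:R * moment rho 4) + 3 * n%:R * (n.+1%:R * moment rho 2) ^+ 2.
    by ring.
  by rewrite rho2; ring.
rewrite -(ler_pM2l N0) e.
move: nd; rewrite /d -natr1; lra.
Qed.

End Final.

Local Open Scope ereal_scope.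

Theorem theorem1p5 (R : realType) :
  exists C : R, (0 < C)%R /\
    forall mu : law R,
      'E_mu[(fun x => x)] = 0 ->
      'V_mu[(fun x => x)] = 1 ->
      infinitely_divisible mu ->
      kolmogorov_distance (normal_prob 0 1) mu
        <= C%:E * sqrte (fourth_moment mu - 3%:E).
Proof.
exists berry_esseen_cst; split=> [|mu muE muV mu_id]; first exact: berry_esseen_cst_gt0.
have C0 := @berry_esseen_cst_gt0 R.
(* An infinite fourth moment makes the right-hand side infinite, since the constant is positive. *)
have [mu4|] := ltP (fourth_moment mu) +oo; last first.
  by rewrite leye_eq => /eqP ->; rewrite /= gt0_muley ?lte_fin// leey.
have mu1 : moment mu 1 = 0%R.
  by move: muE; rewrite unlock /moment /Rintegral => E; rewrite -[RHS]/(fine 0) -E.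
have mu2 : moment mu 2 = 1%R.
  move: muV; rewrite /variance unlock muE /= unlock => V.
  rewrite -[RHS]/(fine 1) -V /moment /Rintegral; congr fine.
  apply: eq_integral => x _ /=.
  by rewrite -[RHS]/(((x - 0) * (x - 0))%R%:E) subr0 expr2.
have m4E : fourth_moment mu = (moment mu 4)%:E.
  rewrite /moment /Rintegral fineK// ge0_fin_numE//.
  by apply: integral_ge0 => x _; rewrite lee_fin exprn_even_ge0.
rewrite m4E -EFinB /= -EFinM.
apply: ge_ereal_sup => _ [z _ <-].
have -> : distribution_function (normal_prob 0 1) z = (Phi z)%:E.
  by rewrite /Phi fineK// fin_num_measure.
have -> : distribution_function mu z = (fine (mu `]-oo, z]%classic))%:E.
  by rewrite fineK// fin_num_measure.
(* The estimate asks for [t] strictly above the root: taking [t] larger by [e / berry_esseen_cst]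
   costs exactly [e]. *)
rewrite -EFinB abse_EFin lee_fin; apply/ler_addgt0Pr => e e0.
set s := Num.sqrt _.
have s0 : (0 <= s)%R by exact: sqrtr_ge0.
have eC : (0 < e / berry_esseen_cst)%R by rewrite divr_gt0.
apply: (le_trans (cdf_estimate_infinitely_divisible mu
  (s + e / berry_esseen_cst) z mu_id mu4 mu1 mu2 _ _)).
- lra.
(* On a negative argument [Num.sqrt] is 0; the strict inequality then holds because a square is
   nonnegative. *)
- have [m3|m3] := leP 0%R (moment mu 4 - 3)%R.
    rewrite -[ltLHS]sqr_sqrtr// -/s ltr_pXn2r// ?nnegrE ?ltrDl//; lra.
  apply: lt_le_trans m3 _; exact: sqr_ge0.
- by rewrite mulrDr lerD2l mulrC divfK// gt_eqF.
Qed.
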